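(* Let $\Omega\subset\mathbb{H}$ be an axially symmetric domain and let $\Delta=\sum_{i=0}^3\partial^2/\partial x_i^2$ be the Laplacian of $\mathbb{R}^4\simeq\mathbb{H}$. (a) If $f\in\mathcal{SR}(\Omega)$ and $\Delta f=0$, then $f$ is a quaternionic affine function of the form $xa+b$, with $a,b\in\mathbb{H}$. (b) If $f\in\mathcal{SR}(\Omega)$, then for every $x\in\Omega\setminus\mathbb{R}$ it holds $$\Delta f=-2\frac{\operatorname{Im}(x)}{|\operatorname{Im}(x)|^2}\left(f'_s-\frac{\partial f}{\partial x}\right)=2\frac{\operatorname{Im}(x)}{|\operatorname{Im}(x)|^2}\left(\overline\partial f+\frac{\partial f}{\partial x}\right)=\frac{\operatorname{Im}(x)}{|\operatorname{Im}(x)|^2}\left(3\frac{\partial f}{\partial x_0}+i\frac{\partial f}{\partial x_1}+j\frac{\partial f}{\partial x_2}+k\frac{\partial f}{\partial x_3}\right).$$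
   Context: $\mathbb{H}$ is the skew field of quaternions, with elements $x=x_0+x_1i+x_2j+x_3k$, $\operatorname{Im}(x)=x_1i+x_2j+x_3k$, $\mathbb{S}=\{J\in\mathbb{H}: J^2=-1\}$. For an open set $D\subseteq\mathbb{C}$ invariant under complex conjugation, put $\Omega_D=\{\alpha+J\beta:\ \alpha+i\beta\in D,\ J\in\mathbb{S}\}\subseteq\mathbb{H}$. An axially symmetric domain is a connected open set $\Omega=\Omega_D$ of this form. A stem function on $D$ is a map $F=F_1+\imath F_2:D\to\mathbb{H}\otimes_{\mathbb{R}}\mathbb{C}$ ($F_1,F_2$ $\mathbb{H}$-valued, $\imath$ the central imaginary unit of the factor $\mathbb{C}$) with $F(\overline z)=\overline{F(z)}$, conjugation acting on the factor $\mathbb{C}$. It induces the slice function $f=\mathcal{I}(F):\Omega_D\to\mathbb{H}$, $f(\alpha+J\beta)=F_1(\alpha+i\beta)+JF_2(\alpha+i\beta)$. For $F$ of class $C^1$, the slice derivative is $\frac{\partial f}{\partial x}=\mathcal{I}(\frac{\partial F}{\partial z})$ with $\frac{\partial}{\partial z}=\frac12(\partial_\alpha-\imath\partial_\beta)$. $f$ is slice-regular if $F$ is holomorphic, i.e. $\frac12(\partial_\alpha+\imath\partial_\beta)F=0$; $\mathcal{SR}(\Omega)$ is the set of slice-regular functions. The spherical derivative of a slice function $f$ is $f'_s(x)=\frac12\operatorname{Im}(x)^{-1}(f(x)-f(\overline x))$ on $\Omega\setminus\mathbb{R}$. The Cauchy-Riemann-Fueter operator is $\overline\partial=\frac12\left(\frac{\partial}{\partial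 x_0}+i\frac{\partial}{\partial x_1}+j\frac{\partial}{\partial x_2}+k\frac{\partial}{\partial x_3}\right)$, with $i,j,k$ acting by left multiplication. *)

(* Defs.v *)
From HB Require Import structures.
From mathcomp Require Import all_boot all_order all_algebra.
From mathcomp Require Import ring lra.
From mathcomp Require Import all_classical all_reals all_analysis.
Set Implicit Arguments.
Unset Strict Implicit.
Unset Printing Implicit Defensive.
Import Order.TTheory GRing.Theory Num.Theory.
Import numFieldNormedType.Exports.
Local Open Scope classical_set_scope.
Local Open Scope ring_scope.

(* The quaternion x0 + x1 i + x2 j + x3 k is the row vector (x0, x1, x2, x3),
   from which the real normed space structure is inherited. Pitfall: the
   inherited norm `|x| is the sup norm of R^4; it is equivalent to the Euclidean
   one, and hence adequate for topology and derivatives, but the quaternionic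
   modulus is qnorm below. *)
Definition quat (R : realType) : Type := 'rV[R]_4.

HB.instance Definition _ (R : realType) := NormedModule.copy (quat R) 'rV[R]_4.

Section Quaternions.
Variable R : realType.
Local Notation H := (quat R).

Definition mkquat (a b c d : R) : H := \row_(i < 4) [:: a; b; c; d]`_i.
Definition q0 (x : H) : R := x 0 0.
Definition q1 (x : H) : R := x 0 1.
Definition q2 (x : H) : R := x 0 2%:R.
Definition q3 (x : H) : R := x 0 3%:R.

Lemma quatP (x y : H) :
  q0 x = q0 y -> q1 x = q1 y -> q2 x = q2 y -> q3 x = q3 y -> x = y.
Proof.
move=> h0 h1 h2 h3; apply/rowP => -[[|[|[|[|//]]]] i4].
- by move: h0; rewrite /q0; congr (x 0 _ = y 0 _); apply: val_inj.
- by move: h1; rewrite /q1; congr (x 0 _ = y 0 _); apply: val_inj.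
- by move: h2; rewrite /q2; congr (x 0 _ = y 0 _); apply: val_inj.
- by move: h3; rewrite /q3; congr (x 0 _ = y 0 _); apply: val_inj.
Qed.

Lemma q0_mk a b c d : q0 (mkquat a b c d) = a. Proof. by rewrite /q0 mxE. Qed.
Lemma q1_mk a b c d : q1 (mkquat a b c d) = b. Proof. by rewrite /q1 mxE. Qed.
Lemma q2_mk a b c d : q2 (mkquat a b c d) = c. Proof. by rewrite /q2 mxE. Qed.
Lemma q3_mk a b c d : q3 (mkquat a b c d) = d. Proof. by rewrite /q3 mxE. Qed.
Lemma q0D x y : q0 (x + y) = q0 x + q0 y. Proof. by rewrite /q0 mxE. Qed.
Lemma q1D x y : q1 (x + y) = q1 x + q1 y. Proof. by rewrite /q1 mxE. Qed.
Lemma q2D x y : q2 (x + y) = q2 x + q2 y. Proof. by rewrite /q2 mxE. Qed.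
Lemma q3D x y : q3 (x + y) = q3 x + q3 y. Proof. by rewrite /q3 mxE. Qed.
Lemma q0N x : q0 (- x) = - q0 x. Proof. by rewrite /q0 mxE. Qed.
Lemma q1N x : q1 (- x) = - q1 x. Proof. by rewrite /q1 mxE. Qed.
Lemma q2N x : q2 (- x) = - q2 x. Proof. by rewrite /q2 mxE. Qed.
Lemma q3N x : q3 (- x) = - q3 x. Proof. by rewrite /q3 mxE. Qed.
Lemma q0Z a x : q0 (a *: x) = a * q0 x. Proof. by rewrite /q0 mxE. Qed.
Lemma q1Z a x : q1 (a *: x) = a * q1 x. Proof. by rewrite /q1 mxE. Qed.
Lemma q2Z a x : q2 (a *: x) = a * q2 x. Proof. by rewrite /q2 mxE. Qed.
Lemma q3Z a x : q3 (a *: x) = a * q3 x. Proof. by rewrite /q3 mxE. Qed.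
Lemma q0_0 : q0 0 = 0. Proof. by rewrite /q0 mxE. Qed.
Lemma q1_0 : q1 0 = 0. Proof. by rewrite /q1 mxE. Qed.
Lemma q2_0 : q2 0 = 0. Proof. by rewrite /q2 mxE. Qed.
Lemma q3_0 : q3 0 = 0. Proof. by rewrite /q3 mxE. Qed.

Definition qE := (q0_mk, q1_mk, q2_mk, q3_mk, q0D, q1D, q2D, q3D,
  q0N, q1N, q2N, q3N, q0Z, q1Z, q2Z, q3Z, q0_0, q1_0, q2_0, q3_0).

Definition qone : H := mkquat 1 0 0 0.

Definition qmul (x y : H) : H := mkquat
  (q0 x * q0 y - q1 x * q1 y - q2 x * q2 y - q3 x * q3 y)
  (q0 x * q1 y + q1 x * q0 y + q2 x * q3 y - q3 x * q2 y)
  (q0 x * q2 y - q1 x * q3 y + q2 x * q0 y + q3 x * q1 y)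
  (q0 x * q3 y + q1 x * q2 y - q2 x * q1 y + q3 x * q0 y).

Lemma qmulA : associative qmul.
Proof. by move=> x y z; apply: quatP; rewrite /qmul !qE; ring. Qed.
Lemma qmul1l : left_id qone qmul.
Proof. by move=> x; apply: quatP; rewrite /qmul /qone !qE; ring. Qed.
Lemma qmul1r : right_id qone qmul.
Proof. by move=> x; apply: quatP; rewrite /qmul /qone !qE; ring. Qed.
Lemma qmulDl : left_distributive qmul +%R.
Proof. by move=> x y z; apply: quatP; rewrite /qmul !qE; ring. Qed.
Lemma qmulDr : right_distributive qmul +%R.
Proof. by move=> x y z; apply: quatP; rewrite /qmul !qE; ring. Qed.
Lemma qone_neq0 : qone != 0.
Proof.
by apply/eqP => /(congr1 q0); rewrite /qone !qE => /eqP; rewrite oner_eq0.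
Qed.

HB.instance Definition _ := GRing.Zmodule_isNzRing.Build H
  qmulA qmul1l qmul1r qmulDl qmulDr qone_neq0.

Lemma q0M (x y : H) :
  q0 (x * y) = q0 x * q0 y - q1 x * q1 y - q2 x * q2 y - q3 x * q3 y.
Proof. by rewrite -[x * y]/(qmul x y) qE. Qed.
Lemma q1M (x y : H) :
  q1 (x * y) = q0 x * q1 y + q1 x * q0 y + q2 x * q3 y - q3 x * q2 y.
Proof. by rewrite -[x * y]/(qmul x y) qE. Qed.
Lemma q2M (x y : H) :
  q2 (x * y) = q0 x * q2 y - q1 x * q3 y + q2 x * q0 y + q3 x * q1 y.
Proof. by rewrite -[x * y]/(qmul x y) qE. Qed.
Lemma q3M (x y : H) :
  q3 (x * y) = q0 x * q3 y + q1 x * q2 y - q2 x * q1 y + q3 x * q0 y.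
Proof. by rewrite -[x * y]/(qmul x y) qE. Qed.
Lemma q0_1 : q0 1 = 1. Proof. exact: q0_mk. Qed.
Lemma q1_1 : q1 1 = 0. Proof. exact: q1_mk. Qed.
Lemma q2_1 : q2 1 = 0. Proof. exact: q2_mk. Qed.
Lemma q3_1 : q3 1 = 0. Proof. exact: q3_mk. Qed.

Definition quatE := (q0M, q1M, q2M, q3M, q0_1, q1_1, q2_1, q3_1, qE).

Lemma qscalerAl (a : R) (x y : H) : a *: (x * y) = (a *: x) * y.
Proof. by apply: quatP; rewrite !quatE; ring. Qed.
HB.instance Definition _ := GRing.Lmodule_isLalgebra.Build R H qscalerAl.
Lemma qscalerAr (a : R) (x y : H) : a *: (x * y) = x * (a *: y).
Proof. by apply: quatP; rewrite !quatE; ring. Qed.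
HB.instance Definition _ := GRing.Lalgebra_isAlgebra.Build R H qscalerAr.

Definition qi : H := mkquat 0 1 0 0.
Definition qj : H := mkquat 0 0 1 0.
Definition qk : H := mkquat 0 0 0 1.

Definition qIm (x : H) : H := q1 x *: qi + q2 x *: qj + q3 x *: qk.
Definition qconj (x : H) : H := (q0 x)%:A - qIm x.
Definition qnorm (x : H) : R :=
  Num.sqrt (q0 x ^+ 2 + q1 x ^+ 2 + q2 x ^+ 2 + q3 x ^+ 2).

Lemma qnorm_sqr (x : H) :
  qnorm x ^+ 2 = q0 x ^+ 2 + q1 x ^+ 2 + q2 x ^+ 2 + q3 x ^+ 2.
Proof. by rewrite sqr_sqrtr// !addr_ge0// sqr_ge0. Qed.

Lemma qnorm_eq0 (x : H) : (qnorm x == 0) = (x == 0).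
Proof.
rewrite -sqrf_eq0 qnorm_sqr; apply/eqP/eqP => [h|->]; last by rewrite !qE; ring.
have [h0 h1 h2 h3] :
  [/\ q0 x ^+ 2 = 0, q1 x ^+ 2 = 0, q2 x ^+ 2 = 0 & q3 x ^+ 2 = 0].
  by have := (sqr_ge0 (q0 x), sqr_ge0 (q1 x), sqr_ge0 (q2 x), sqr_ge0 (q3 x));
     case=> [[[? ?] ?] ?]; split; lra.
by apply: quatP; rewrite qE; apply/eqP; rewrite -sqrf_eq0; apply/eqP.
Qed.

Definition qinv (x : H) : H := (qnorm x ^+ 2)^-1 *: qconj x.

Lemma qmulVx : {in [pred x : H | x != 0], left_inverse 1 qinv *%R}.
Proof.
move=> x; rewrite inE /= => x0.
have : qnorm x ^+ 2 != 0 by rewrite sqrf_eq0 qnorm_eq0.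
rewrite /qinv qnorm_sqr => n0.
by apply: quatP; rewrite /qconj /qIm /qi /qj /qk !quatE; field.
Qed.
Lemma qmulxV : {in [pred x : H | x != 0], right_inverse 1 qinv *%R}.
Proof.
move=> x; rewrite inE /= => x0.
have : qnorm x ^+ 2 != 0 by rewrite sqrf_eq0 qnorm_eq0.
rewrite /qinv qnorm_sqr => n0.
by apply: quatP; rewrite /qconj /qIm /qi /qj /qk !quatE; field.
Qed.
Lemma qunitP (x y : H) : y * x = 1 /\ x * y = 1 -> x != 0.
Proof.
by case=> + _; apply: contra_eq_neq => ->; rewrite mulr0 eq_sym oner_neq0.
Qed.
Lemma qinv_out : {in [predC [pred x : H | x != 0]], qinv =1 id}.
Proof.
move=> x; rewrite !inE negbK => /eqP ->.
by apply: quatP; rewrite /qinv /qconj /qIm !quatE; ring.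
Qed.
HB.instance Definition _ := GRing.NzRing_hasMulInverse.Build H
  qmulVx qmulxV qunitP qinv_out.

Definition imunit : set H := [set J | J * J = -1].

End Quaternions.

Section SliceFunctions.
Variable R : realType.
Local Notation H := (quat R).
(* alpha + i beta is the pair (alpha, beta); only the real vector space
   structure and the conjugation of C are used. *)
Local Notation C := (R * R)%type.
(* F1 + I F2, with I the central imaginary unit, is the pair (F1, F2). *)
Local Notation HC := (H * H)%type.

(* Conjugation with respect to the factor C, both on C and on H (x) C. *)
Definition cconj (V : zmodType) (z : V * V) : V * V := (z.1, - z.2).

Definition imul (w : HC) : HC := (- w.2, w.1).

Definition conj_invariant (D : set C) := forall z, D z -> D (cconj z).

Definition Omega (D : set C) : set H :=
  [set x | exists a b J, [/\ D (a, b), imunit J & x = a%:A + J * b%:A]].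

Definition axially_symmetric_domain (D : set C) (W : set H) :=
  [/\ open D, conj_invariant D, W = Omega D, open W & connected W].

Definition stem (D : set C) (F : C -> HC) :=
  forall z, D z -> F (cconj z) = cconj (F z).

Definition C1_on (D : set C) (F : C -> HC) := forall z, D z ->
  [/\ derivable F z (1, 0), derivable F z (0, 1),
      {for z, continuous ('D_(1, 0) F)} & {for z, continuous ('D_(0, 1) F)}].

Definition dz (F : C -> HC) (z : C) : HC :=
  2^-1 *: ('D_(1, 0) F z - imul ('D_(0, 1) F z)).
Definition dzbar (F : C -> HC) (z : C) : HC :=
  2^-1 *: ('D_(1, 0) F z + imul ('D_(0, 1) F z)).

Definition holomorphic_stem (D : set C) (F : C -> HC) :=
  [/\ stem D F, C1_on D F & forall z, D z -> dzbar F z = 0].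

(* The slice function induced by F, evaluated through the representation
   x = alpha + J beta with beta = |Im x| and J = Im x / |Im x| (J = 0 for real
   x, where F2 vanishes anyway); by slice_funE below, for a stem function F the
   value F1 + J F2 is obtained for every representation of x. *)
Definition slice_fun (F : C -> HC) (x : H) : H :=
  let w := F (q0 x, qnorm (qIm x)) in
  w.1 + ((qnorm (qIm x))^-1 *: qIm x) * w.2.

Lemma imunitP (J : H) :
  imunit J <-> q0 J = 0 /\ q1 J ^+ 2 + q2 J ^+ 2 + q3 J ^+ 2 = 1.
Proof.
split=> [JJ|[J0 J1]]; last first.
  by apply: quatP; rewrite !quatE J0; lra.
have h0 := congr1 (@q0 R) JJ; have h1 := congr1 (@q1 R) JJ.
have h2 := congr1 (@q2 R) JJ; have h3 := congr1 (@q3 R) JJ.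
rewrite !quatE in h0 h1 h2 h3.
have [z|nz] := eqVneq (q0 J) 0; first by split=> //; move: h0; rewrite z; lra.
exfalso.
have e1 : q1 J = 0 by apply: (mulfI nz); lra.
have e2 : q2 J = 0 by apply: (mulfI nz); lra.
have e3 : q3 J = 0 by apply: (mulfI nz); lra.
by move: h0; rewrite e1 e2 e3; have := sqr_ge0 (q0 J); lra.
Qed.

Lemma slice_funE (D : set C) (F : C -> HC) (a b : R) (J : H) :
  stem D F -> D (a, b) -> imunit J ->
  slice_fun F (a%:A + J * b%:A) = (F (a, b)).1 + J * (F (a, b)).2.
Proof.
move=> sF Dab /imunitP[J0 J1]; set x := _ + _ * _.
have x0 : q0 x = a by rewrite /x !quatE J0; ring.
have xI : qIm x = b *: J.
  by apply: quatP; rewrite /qIm /qi /qj /qk /x !quatE ?J0; ring.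
have xn : qnorm (qIm x) = `|b|.
  rewrite xI -sqrtr_sqr; congr Num.sqrt; rewrite !quatE J0.
  by rewrite -[RHS]mulr1 -J1; ring.
rewrite /slice_fun xn x0 xI scalerA.
have sFab : F (a, - b) = cconj (F (a, b)) by exact: sF Dab.
case: (ltrgtP b 0) => b0.
- rewrite ltr0_norm// sFab /= invrN mulNr mulVf ?ltr0_neq0// scaleN1r mulrNN //.
- by rewrite gtr0_norm// mulVf ?gt_eqF// scale1r.
- have F2 : (F (a, b)).2 = 0.
    move: sFab; rewrite b0 oppr0 => /(congr1 snd)/= /eqP.
    rewrite -subr_eq0 opprK -mulr2n -scaler_nat scaler_eq0 pnatr_eq0/=.
    by move/eqP.
  by have -> : `|b| = b by [rewrite b0 normr0]; rewrite F2 !mulr0.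
Qed.

(* Functions on an open set W of quaternions are total functions H -> H of
   which only the values on W matter. *)
Definition induced_on (W : set H) (F : C -> HC) (f : H -> H) :=
  forall x, W x -> f x = slice_fun F x.

Definition slice_regular (D : set C) (f : H -> H) :=
  exists2 F, holomorphic_stem D F & induced_on (Omega D) F f.

Definition slice_derivative (F : C -> HC) : H -> H := slice_fun (dz F).

Definition spherical_derivative (f : H -> H) (x : H) : H :=
  2^-1 *: ((qIm x)^-1 * (f x - f (qconj x))).

Definition CRF (f : H -> H) (x : H) : H :=
  2^-1 *: ('D_1 f x + qi R * 'D_(qi R) f x + qj R * 'D_(qj R) f x
           + qk R * 'D_(qk R) f x).

Definition laplacian (f : H -> H) (x : H) : H :=
  'D_1 ('D_1 f) x + 'D_(qi R) ('D_(qi R) f) x + 'D_(qj R) ('D_(qj R) f) x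
  + 'D_(qk R) ('D_(qk R) f) x.

End SliceFunctions.

(* Main.v *)
Require Import Defs.
From HB Require Import structures.
From mathcomp Require Import all_boot all_order all_algebra.
From mathcomp Require Import ring lra.
From mathcomp Require Import all_classical all_reals all_analysis.
Set Implicit Arguments.
Unset Strict Implicit.
Unset Printing Implicit Defensive.
Import Order.TTheory GRing.Theory Num.Theory.
Import numFieldNormedType.Exports.
Local Open Scope classical_set_scope.
Local Open Scope ring_scope.

(* The stem function is only assumed C^1, so the Laplacian requires a regularity
   theorem. For a C^1 Cauchy-Riemann pair u + i v with u_a = p, put
     Phi r = int_0^{2 pi} (u cos t + v sin t)(z + r e^{i t}) dt,
   the real part of the integral of e^{-i t} (u + i v)(z + r e^{i t}). Then
   Phi' r = M r, where M r = int p (z + r e^{i t}) dt, and integrating the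
   derivative of u sin - v cos along the circle gives Phi r = r M r. Hence M is
   constant on r > 0, equal to its value 2 pi p z at 0, and
     p z = (2 pi r)^-1 Phi r.
   Since u and v are C^1, this can be differentiated in z under the integral, so
   p has partial derivatives and u is harmonic.

   Along a line in a coordinate direction only alpha or only beta = |Im x|
   varies, so the derivatives of the slice function reduce to the pure second
   partial derivatives of F1 and F2, and summing over the directions gives (b).

   If the Laplacian vanishes, (b) on a sphere, applied with J and -J, yields
   d_a F2 = 0 and d_a F1 = F2 / beta; with the Cauchy-Riemann equations both
   a = F2 / beta and b = F1 - alpha a are locally constant, up to beta = 0 by
   continuity. So f is locally x a + b, and (a, b) is determined by the germ, hence
   constant on the connected domain. *)

(** * Derivatives along curves in the plane *)

Section RealDerivatives.
Context {R : realType}.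
Implicit Types (f g : R -> R) (t : R).

Lemma is_derive_add {f g t df dg} : is_derive t 1 f df -> is_derive t 1 g dg ->
  is_derive t 1 (fun s => f s + g s) (df + dg).
Proof. exact: is_deriveD. Qed.

Lemma is_derive_opp {f t df} : is_derive t 1 f df ->
  is_derive t 1 (fun s => - f s) (- df).
Proof. exact: is_deriveN. Qed.

Lemma is_derive_mul {f g t df dg} : is_derive t 1 f df -> is_derive t 1 g dg ->
  is_derive t 1 (fun s => f s * g s) (df * g t + f t * dg).
Proof.
move=> hf hg; have h := is_deriveM hf hg; apply: (is_derive_eq h).
by rewrite addrC [_ *: df]mulrC.
Qed.

Lemma is_derive_near {f g t df} : (\near t, f t = g t) ->
  is_derive t 1 f df -> is_derive t 1 g df.
Proof. exact: near_eq_is_derive. Qed.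

Lemma is_derive_affine (a c t : R) : is_derive t 1 (fun s => a + s * c) c.
Proof.
have h := is_derive_add (is_derive_cst a t 1)
  (is_derive_mul (is_derive_id t 1) (is_derive_cst c t 1)).
apply: (is_derive_eq h).
by rewrite add0r mulr0 addr0 mul1r.
Qed.

Lemma is_derive_continuous {f t df} : is_derive t 1 f df -> {for t, continuous f}.
Proof.
by move=> [df' _]; exact/differentiable_continuous/derivable1_diffP.
Qed.

(** The mean value theorem with endpoints in either order. The intermediate point is only located in
    the ball, which is enough for the continuity estimates below. *)
Lemma MVT_ball {f df : R -> R} {x0 d a b : R} :
  (forall x, `|x - x0| < d -> is_derive x 1 f (df x)) ->
  `|a - x0| < d -> `|b - x0| < d ->
  exists2 c, `|c - x0| < d & f b - f a = df c * (b - a).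
Proof.
move=> fdf; wlog ab : a b / a <= b => [W|] a0 b0.
  have [/W|/ltW ba] := leP a b; first exact.
  have [c c0 E] := W _ _ ba b0 a0; exists c => //.
  by rewrite -(opprB (f a)) E -mulrN opprB.
have itvd x : x \in `[a, b] -> `|x - x0| < d.
  rewrite in_itv/= => /andP[ax xb].
  by move: a0 b0; rewrite !ltr_norml => /andP[? ?] /andP[? ?]; apply/andP; split; lra.
have H1 x : x \in `]a, b[ -> is_derive x 1 f (df x).
  by move=> /subset_itv_oo_cc/itvd/fdf.
have H2 : {within `[a, b], continuous f}.
  by apply: derivable_within_continuous => x /itvd/fdf[].
by have [c /itvd c0 E] := MVT_segment ab H1 H2; exists c.
Qed.

End RealDerivatives.

(** * Partial derivatives and the chain rule along plane curves *)

Section Boxes.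
Context {R : realType}.
Implicit Types (z w : R * R) (d : R).

Definition box z d : set (R * R) :=
  [set w | `|w.1 - z.1| < d /\ `|w.2 - z.2| < d].

Lemma nbhs_box z (A : set (R * R)) :
  nbhs z A <-> exists2 d, 0 < d & box z d `<=` A.
Proof.
have boxE d : box z d = ball z d.
  by apply/seteqP; split=> w [w1 w2]; split; rewrite /ball/= distrC.
split=> [/nbhs_ballP[d d0 dA]|[d d0 dA]]; first by exists d => //; rewrite boxE.
by apply/nbhs_ballP; exists d => //=; rewrite -boxE.
Qed.

Lemma box_center z d : 0 < d -> box z d z.
Proof. by move=> d0; split; rewrite subrr normr0. Qed.

Lemma box_nbhs {z d w} : box z d w -> nbhs w (box z d).
Proof.
move=> [w1 w2]; apply/nbhs_box.
exists (Num.min (d - `|w.1 - z.1|) (d - `|w.2 - z.2|)).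
  by rewrite lt_min !subr_gt0 w1 w2.
move=> v []; rewrite !lt_min => /andP[v1 _] /andP[_ v2].
by split; [have := ler_distD w.1 v.1 z.1|have := ler_distD w.2 v.2 z.2]; lra.
Qed.

(** Partial derivatives are one-variable derivatives along coordinate lines; joint differentiability
    is not presupposed. *)
Definition has_partials (B : set (R * R)) (u ua ub : R * R -> R) :=
  forall z, B z -> is_derive z.1 1 (fun s => u (s, z.2)) (ua z) /\
                   is_derive z.2 1 (fun s => u (z.1, s)) (ub z).

Lemma is_derive_curve (B : set (R * R)) (u ua ub : R * R -> R)
    (p q : R -> R) (t dp dq : R) :
  has_partials B u ua ub -> nbhs (p t, q t) B ->
  {for (p t, q t), continuous ua} -> {for (p t, q t), continuous ub} ->
  is_derive t 1 p dp -> is_derive t 1 q dq ->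
  is_derive t 1 (fun s => u (p s, q s))
    (ua (p t, q t) * dp + ub (p t, q t) * dq).
Proof.
set z := (p t, q t) => uB zB ca cb hp hq.
(* Caratheodory: u w - u z = A w (w.1 - z.1) + A' w (w.2 - z.2) with A and A'
   continuous at z. *)
pose A w := if w.1 == z.1 then ua z
            else (u (w.1, w.2) - u (z.1, w.2)) / (w.1 - z.1).
pose A' w := if w.2 == z.2 then ub z
            else (u (z.1, w.2) - u (z.1, z.2)) / (w.2 - z.2).
have uE w : u w - u z = A w * (w.1 - z.1) + A' w * (w.2 - z.2).
  have -> : A w * (w.1 - z.1) = u (w.1, w.2) - u (z.1, w.2).
    rewrite /A; case: eqVneq => [->|n]; first by rewrite !subrr mulr0.
    by rewrite divfK// subr_eq0.
  have -> : A' w * (w.2 - z.2) = u (z.1, w.2) - u (z.1, z.2).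
    rewrite /A'; case: eqVneq => [->|n]; first by rewrite !subrr mulr0.
    by rewrite divfK// subr_eq0.
  by case: w => w1 w2; rewrite /z /=; ring.
(* The mean value theorem in the first variable makes [A w] a value of [ua] at a point of the box.
   That point has height [w.2], so joint continuity of [ua] at [z] is used. *)
have cA : {for z, continuous A}.
  have Az : A z = ua z by rewrite /A eqxx.
  apply/cvgrPdist_lt => e e0; rewrite Az.
  have /cvgrPdist_lt /(_ e e0) zE := ca.
  have [d d0 dE] := (nbhs_box _ _).1 (filterI zE zB).
  apply/nbhs_box; exists d => // w [w1 w2].
  rewrite /A; case: eqVneq => [_|n]; first by rewrite subrr normr0.
  have [|||c c0 ->] := @MVT_ball _ (fun s => u (s, w.2)) (fun s => ua (s, w.2))
    z.1 d z.1 w.1 => //.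
  - move=> x xz; have [|_ Bx] := dE (x, w.2); first by split.
    by have [] := uB _ Bx.
  - by rewrite subrr normr0.
  - rewrite mulfK ?subr_eq0//.
    by have [|] := dE (c, w.2); first by split.
have cA' : {for z, continuous A'}.
  have Az : A' z = ub z by rewrite /A' eqxx.
  apply/cvgrPdist_lt => e e0; rewrite Az.
  have /cvgrPdist_lt /(_ e e0) zE := cb.
  have [d d0 dE] := (nbhs_box _ _).1 (filterI zE zB).
  apply/nbhs_box; exists d => // w [w1 w2].
  rewrite /A'; case: eqVneq => [_|n]; first by rewrite subrr normr0.
  have z1 : `|z.1 - z.1| < d by rewrite subrr normr0.
  have [|||c c0 ->] := @MVT_ball _ (fun s => u (z.1, s)) (fun s => ub (z.1, s))
    z.2 d z.2 w.2 => //.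
  - move=> x xz; have [|_ Bx] := dE (z.1, x); first by split.
    by have [] := uB _ Bx.
  - by rewrite subrr normr0.
  - rewrite mulfK ?subr_eq0//.
    by have [|] := dE (z.1, c); first by split.
have /is_derive1_caratheodory [gp [pE cgp gpt]] := hp.
have /is_derive1_caratheodory [gq [qE cgq gqt]] := hq.
have cz : {for t, continuous (fun s => (p s, q s))}.
  have cp := is_derive_continuous hp; have cq := is_derive_continuous hq.
  exact: (cvg_pair cp cq).
apply/is_derive1_caratheodory.
exists (fun s => A (p s, q s) * gp s + A' (p s, q s) * gq s); split.
- by move=> s; rewrite uE /= pE qE; ring.
- have cAz : {for t, continuous (fun s => A (p s, q s))}.
    exact: (@continuous_comp _ _ _ (fun s => (p s, q s)) A).
  have cAz' : {for t, continuous (fun s => A' (p s, q s))}.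
    exact: (@continuous_comp _ _ _ (fun s => (p s, q s)) A').
  exact: (continuousD (continuousM cAz cgp) (continuousM cAz' cgq)).
- by rewrite gpt gqt /A /A' !eqxx.
Qed.

End Boxes.

(** * Integrals over a segment: fundamental theorem and differentiation under the integral *)

Section SegmentIntegrals.
Context {R : realType}.
Local Notation mu := (@lebesgue_measure R).
Variable c : R.
Hypothesis c0 : 0 < c.
Implicit Types (f g df : R -> R).

Lemma continuous_integrable f : continuous f ->
  mu.-integrable `[0, c] (EFin \o f).
Proof.
move=> cf; apply: continuous_compact_integrable; first exact: segment_compact.
exact: continuous_subspaceT.
Qed.

Lemma Rintegral_derive f df : (forall t : R, is_derive t 1 f (df t)) ->
  continuous df -> \int[mu]_(t in `[0, c]) df t = f c - f 0.
Proof.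
move=> fdf cdf.
have cf : continuous f by move=> t; exact: is_derive_continuous (fdf t).
rewrite /Rintegral (@continuous_FTC2 _ df f)//.
- exact: continuous_subspaceT.
- split; first by move=> t _; have [] := fdf t.
    by apply: cvg_at_right_filter; exact: cf.
  by apply: cvg_at_left_filter; exact: cf.
- by move=> t _; rewrite derive1E; have [] := fdf t.
Qed.

(** Differentiation under the integral by domination: the constant [M] is integrable because the
    segment has finite length. *)
Lemma is_derive_Rintegral (f f' : R -> R -> R) (a d M : R) : 0 < d ->
  (forall x, `|x - a| < d -> continuous (f x)) ->
  (forall x t, `|x - a| < d -> is_derive x 1 (f^~ t) (f' x t)) ->
  (forall x t, `|x - a| < d -> `|f' x t| <= M) ->
  is_derive a 1 (fun x => \int[mu]_(t in `[0, c]) f x t)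
                (\int[mu]_(t in `[0, c]) f' a t).
Proof.
move=> d0 cf ff' fM.
have aa : `|a - a| < d by rewrite subrr normr0.
have M0 : 0 <= M by exact: le_trans (fM _ 0 aa).
have itvE x : x \in `](a - d), (a + d)[ -> `|x - a| < d.
  by rewrite in_itv/= ltr_norml => /andP[? ?]; apply/andP; split; lra.
have Ia : `](a - d), (a + d)[%classic a.
  by rewrite /= in_itv/=; apply/andP; split; lra.
have mI : measurable (`[0, c]%classic : set (measurableTypeR R)) by [].
have h1 x : `](a - d), (a + d)[%classic x ->
    mu.-integrable `[0, c] (EFin \o f x).
  by move=> /itvE/cf; exact: continuous_integrable.
have h2 x t : `](a - d), (a + d)[%classic x -> `[0, c]%classic t ->
    derivable (f^~ t) x 1.
  by move=> /itvE xa _; have [] := ff' x t xa.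
have h3 : mu.-integrable `[0, c] (EFin \o (fun=> M)).
  by apply: continuous_integrable; exact: cst_continuous.
have h4 x t : `](a - d), (a + d)[%classic x -> `[0, c]%classic t ->
    `|partial1of2 f x t| <= M.
  move=> /itvE xa _; rewrite partial1of2E.
  by have [_ ->] := ff' x t xa; exact: fM.
have D1 := @derivable_under_integral R _ _ mu f _ mI _ _ _ Ia h1 h2 _ (fun=> M0) h3 h4.
have D2 := @differentiation_under_integral R _ _ mu f _ mI _ _ _ Ia h1 h2 _ (fun=> M0) h3 h4.
apply: DeriveDef; first exact: D1.
rewrite -derive1E [LHS]D2.
by apply: eq_Rintegral => t _; rewrite partial1of2E; have [] := ff' a t aa.
Qed.

End SegmentIntegrals.

(** * Regularity of Cauchy-Riemann pairs *)

Section CauchyRiemann.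
Context {R : realType}.
Local Notation mu := (@lebesgue_measure R).
Local Notation c := (@pi R *+ 2).
Implicit Types (r s t x : R) (z w : R * R) (u v p q : R * R -> R).

(** [p - i q] is the complex derivative of [u + i v]: the equations are built in by prescribing the
    partial derivatives of [v] as [- q] and [p]. *)
Definition cauchy_riemann (B : set (R * R)) u v p q :=
  [/\ has_partials B u p q, has_partials B v (fun z => - q z) p,
      forall z, B z -> {for z, continuous p} &
      forall z, B z -> {for z, continuous q}].

(** This is multiplication of [u + i v] by [- i]. It carries results about [p] over to [- q]. *)
Lemma cauchy_riemann_rot B u v p q : cauchy_riemann B u v p q ->
  cauchy_riemann B v (fun z => - u z) (fun z => - q z) p.
Proof.
move=> [uB vB cp cq]; split=> //.
- by move=> z /uB[u1 u2]; split; exact: is_derive_opp.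
- by move=> z /cq; exact: continuousN.
Qed.

Definition circ z (r t : R) : R * R := (z.1 + r * cos t, z.2 + r * sin t).

Lemma circ0 z t : circ z 0 t = z.
Proof. by case: z => a b; rewrite /circ !mul0r !addr0. Qed.

Variables (z0 : R * R) (e M : R) (u v p q : R * R -> R).
Local Notation B := (box z0 (e + e)).
Hypothesis uvB : cauchy_riemann B u v p q.
Hypothesis pM : forall z, B z -> `|p z| <= M.
Hypothesis qM : forall z, B z -> `|q z| <= M.

(** Hypotheses are made on the box of half-width [e + e] so that circles of radius below [e] may
    have their centre anywhere in the smaller box; the centre has to vary when differentiating in
    [z]. *)
Lemma circ_box z r t : box z0 e z -> `|r| < e -> B (circ z r t).
Proof.
move=> [z1 z2] re; rewrite /circ; split=> /=.
- have : `|r * cos t| <= `|r|.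
    by rewrite normrM ler_piMr// cos_max.
  by have := ler_normD (z.1 - z0.1) (r * cos t); rewrite addrAC; lra.
- have : `|r * sin t| <= `|r|.
    by rewrite normrM ler_piMr// sin_max.
  by have := ler_normD (z.2 - z0.2) (r * sin t); rewrite addrAC; lra.
Qed.

Section Curves.
Variables (a b : R -> R) (t da db : R).
Hypothesis abB : B (a t, b t).
Hypotheses (ha : is_derive t 1 a da) (hb : is_derive t 1 b db).

Lemma is_derive_re_curve : is_derive t 1 (fun s => u (a s, b s))
  (p (a t, b t) * da + q (a t, b t) * db).
Proof.
have [uB _ cp cq] := uvB.
by apply: is_derive_curve uB (box_nbhs abB) _ _ ha hb; [exact: cp|exact: cq].
Qed.

Lemma is_derive_im_curve : is_derive t 1 (fun s => v (a s, b s))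
  (- q (a t, b t) * da + p (a t, b t) * db).
Proof.
have [_ vB cp cq] := uvB.
apply: is_derive_curve vB (box_nbhs abB) _ _ ha hb; last exact: cp.
by apply: continuousN; exact: cq.
Qed.

End Curves.

Section Circles.
Variables (z : R * R) (r : R).
Hypotheses (ze : box z0 e z) (re : `|r| < e).

Lemma is_derive_circ1 t : is_derive t 1 (fun s => (circ z r s).1) (- r * sin t).
Proof.
have h := is_derive_add (is_derive_cst z.1 t 1)
  (is_derive_mul (is_derive_cst r t 1) (is_derive_cos t)).
by apply: (is_derive_eq h); rewrite /cst; ring.
Qed.

Lemma is_derive_circ2 t : is_derive t 1 (fun s => (circ z r s).2) (r * cos t).
Proof.
have h := is_derive_add (is_derive_cst z.2 t 1)
  (is_derive_mul (is_derive_cst r t 1) (is_derive_sin t)).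
by apply: (is_derive_eq h); rewrite /cst; ring.
Qed.

Lemma is_derive_re_circ t : is_derive t 1 (fun s => u (circ z r s))
  (p (circ z r t) * (- r * sin t) + q (circ z r t) * (r * cos t)).
Proof.
apply: (@is_derive_re_curve (fun s => (circ z r s).1) (fun s => (circ z r s).2));
  [exact: circ_box|exact: is_derive_circ1|exact: is_derive_circ2].
Qed.

Lemma is_derive_im_circ t : is_derive t 1 (fun s => v (circ z r s))
  (- q (circ z r t) * (- r * sin t) + p (circ z r t) * (r * cos t)).
Proof.
apply: (@is_derive_im_curve (fun s => (circ z r s).1) (fun s => (circ z r s).2));
  [exact: circ_box|exact: is_derive_circ1|exact: is_derive_circ2].
Qed.

Lemma continuous_circ : continuous (circ z r).
Proof.
move=> t; have c1 := is_derive_continuous (is_derive_circ1 t).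
have c2 := is_derive_continuous (is_derive_circ2 t).
exact: (cvg_pair c1 c2).
Qed.

Lemma continuous_re_circ : continuous (fun t => u (circ z r t)).
Proof. by move=> t; exact: is_derive_continuous (is_derive_re_circ t). Qed.

Lemma continuous_im_circ : continuous (fun t => v (circ z r t)).
Proof. by move=> t; exact: is_derive_continuous (is_derive_im_circ t). Qed.

Lemma continuous_p_circ : continuous (fun t => p (circ z r t)).
Proof.
move=> t; have [_ _ cp _] := uvB.
apply: (@continuous_comp _ _ _ (circ z r) p); first exact: continuous_circ.
exact/cp/circ_box.
Qed.

Lemma continuous_trig (f g : R -> R) : continuous f -> continuous g ->
  continuous (fun t => f t * cos t + g t * sin t).
Proof.
move=> cf cg t.
have h1 : {for t, continuous (fun t => f t * cos t)}.
  by apply: continuousM; [exact: cf|exact: continuous_cos].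
have h2 : {for t, continuous (fun t => g t * sin t)}.
  by apply: continuousM; [exact: cg|exact: continuous_sin].
exact: (continuousD h1 h2).
Qed.

Definition integrand t : R := u (circ z r t) * cos t + v (circ z r t) * sin t.

Lemma continuous_integrand : continuous integrand.
Proof.
exact: continuous_trig continuous_re_circ continuous_im_circ.
Qed.

(* The derivative of u sin - v cos along the circle is the integrand minus
   r p. *)
Lemma Rintegral_integrand : \int[mu]_(t in `[0, c]) integrand t =
  r * \int[mu]_(t in `[0, c]) p (circ z r t).
Proof.
have c0 : 0 < c by rewrite pmulrn_rgt0// pi_gt0.
have ck : continuous (fun t => integrand t - r * p (circ z r t)).
  move=> t; apply: (continuousB (@continuous_integrand t)).
  exact: (continuousM (@cst_continuous _ _ r t) (@continuous_p_circ t)).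
pose g t := u (circ z r t) * sin t - v (circ z r t) * cos t.
have gk t : is_derive t 1 g (integrand t - r * p (circ z r t)).
  have h := is_derive_add (is_derive_mul (is_derive_re_circ t) (is_derive_sin t))
    (is_derive_opp (is_derive_mul (is_derive_im_circ t) (is_derive_cos t))).
  apply: (is_derive_eq h); rewrite /integrand.
  rewrite -[X in _ = _ - r * X]mulr1 -(cos2Dsin2 t); ring.
(* [g] takes the same value at 0 and at [2 pi], so the integral of its derivative vanishes. *)
have := Rintegral_derive c0 gk ck.
rewrite /g /circ cos2pi sin2pi cos0 sin0 subrr => /eqP.
rewrite RintegralB//; last 2 first.
- exact/continuous_integrable/continuous_integrand.
- apply: continuous_integrable => // t.
  exact: (continuousM (@cst_continuous _ _ r t) (@continuous_p_circ t)).
rewrite subr_eq0 => /eqP ->; rewrite RintegralZl//.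
exact/continuous_integrable/continuous_p_circ.
Qed.

End Circles.

Definition circle_integral z r := \int[mu]_(t in `[0, c]) integrand z r t.

(** The factor [e^(-i t)] cancels the radial direction [e^(i t)] and leaves the real part of
    [p - i q]. Zero and negative radii are included, so the derivative at radius 0 is two-sided. *)
Lemma is_derive_circle_integral z r : box z0 e z -> `|r| < e ->
  is_derive r 1 (circle_integral z) (\int[mu]_(t in `[0, c]) p (circ z r t)).
Proof.
move=> ze re.
have ball x : `|x - r| < e - `|r| -> `|x| < e.
  by move=> xr; have := ler_normD (x - r) r; rewrite subrK; lra.
rewrite -[circle_integral z]/(fun x => \int[mu]_(t in `[0, c]) integrand z x t).
apply: (@is_derive_Rintegral _ c (integrand z) (fun x t => p (circ z x t)) _
  (e - `|r|) M).
- by rewrite subr_gt0.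
- by move=> x /ball xe; exact: continuous_integrand.
- move=> x t /ball xe.
  have h1 := is_derive_affine z.1 (cos t) x.
  have h2 := is_derive_affine z.2 (sin t) x.
  have zB := circ_box t ze xe.
  have hu := @is_derive_re_curve (fun x => z.1 + x * cos t)
    (fun x => z.2 + x * sin t) _ _ _ zB h1 h2.
  have hv := @is_derive_im_curve (fun x => z.1 + x * cos t)
    (fun x => z.2 + x * sin t) _ _ _ zB h1 h2.
  have h := is_derive_add (is_derive_mul hu (is_derive_cst (cos t) x 1))
    (is_derive_mul hv (is_derive_cst (sin t) x 1)).
  apply: (is_derive_eq h); rewrite /cst -/(circ z x t).
  by rewrite -[RHS]mulr1 -(cos2Dsin2 t); ring.
- by move=> x t /ball xe; exact/pM/circ_box.
Qed.

Lemma circle_integralE z r : box z0 e z -> 0 < r < e ->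
  circle_integral z r = c * r * p z.
Proof.
move=> ze /andP[r0 re].
have c0 : 0 < c by rewrite pmulrn_rgt0// pi_gt0.
pose m s := \int[mu]_(t in `[0, c]) p (circ z s t).
have hm s : `|s| < e -> is_derive s 1 (circle_integral z) (m s).
  exact: is_derive_circle_integral.
have hE s : `|s| < e -> circle_integral z s = s * m s.
  by move=> se; rewrite /circle_integral Rintegral_integrand.
have e0 : `|0 : R| < e by rewrite normr0 (lt_trans r0).
(* The circle of radius 0 is the constant curve at [z]. *)
have m0 : m 0 = c * p z.
  rewrite /m; under eq_Rintegral do rewrite circ0.
  rewrite Rintegral_cst//= lebesgue_measure_itv/= lte_fin c0 -EFinB/=.
  by rewrite subr0 mulrC.
(* The interval from 0 to [e] is rewritten as the ball of centre and radius [e / 2], the form that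
   [MVT_ball] takes. *)
have itv s : 0 < s < e -> `|s - e / 2| < e / 2.
  by move=> /andP[? ?]; rewrite ltr_norml; apply/andP; split; lra.
have itv' s : `|s - e / 2| < e / 2 -> 0 < s < e.
  by rewrite ltr_norml => /andP[? ?]; apply/andP; split; lra.
have abs s : 0 < s < e -> `|s| < e by move=> /andP[s0 ?]; rewrite gtr0_norm.
have quot s : `|s - e / 2| < e / 2 -> is_derive s 1
    (fun s => circle_integral z s * s^-1) ((fun=> 0) s).
  move=> /itv' sI; have s0 : s != 0 by case/andP: sI => /gt_eqF ->.
  have h := is_derive_mul (hm _ (abs _ sI)) (is_deriveV s0 (is_derive_id s 1)).
  apply: (is_derive_eq h); rewrite hE ?abs//.
  rewrite /GRing.scale/=; field.
  exact: s0.
have rI : 0 < r < e by rewrite r0 re.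
have mr s : 0 < s < e -> m s = m r.
  move=> sI; have [w _] := MVT_ball quot (itv _ sI) (itv _ rI).
  rewrite [X in X -> _]/= mul0r => /eqP; rewrite subr_eq0 !hE ?abs// ![_ * m _]mulrC !mulfK => [/eqP -> //||].
    by case/andP: sI => /gt_eqF ->.
  by rewrite gt_eqF.
(* [G] is the slope of the circle integral at 0. It equals the constant [m r] for small positive
   [s], and [m 0] at 0; its continuity identifies the two. *)
have /is_derive1_caratheodory [G [GE cG G0]] := hm 0 e0.
have Gs s : 0 < s < e -> G s = m r.
  move=> sI; have := GE s; rewrite (hE 0)// (hE s) ?abs// mul0r !subr0 mr// mulrC.
  by move=> /mulIf ->//; case/andP: sI => /gt_eqF ->.
rewrite hE ?gtr0_norm// -mulrA mulrCA -m0 -G0; congr (r * _).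
apply/eqP; rewrite -subr_eq0 -normr_eq0; apply/eqP.
apply: contrapT => /eqP; rewrite -normr_gt0 normr_id => n0.
have /cvgrPdist_lt /(_ _ n0) [/= d d0 dG] := cG.
(* This [s] lies in the ball of continuity and strictly between 0 and [e], so [G s = m r] and the
   distance from [m r] to [G 0] would be smaller than itself. *)
pose s := Num.min (d / 2) (e / 2).
have s0 : 0 < s by rewrite lt_min !divr_gt0// (lt_trans r0).
have sd : s <= d / 2 by rewrite ge_min lexx.
have se : s <= e / 2 by rewrite ge_min lexx orbT.
have sI : 0 < s < e by rewrite s0/=; move: r0; lra.
have /dG : ball_ Num.norm 0 d s.
  by rewrite /ball_/= sub0r normrN gtr0_norm//; lra.
by rewrite (Gs _ sI) distrC ltxx.
Qed.

(** The right-hand side involves only [u] and [v], which are C^1; this is where [p] gains a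
    derivative. *)
Lemma p_circle_integral z r : box z0 e z -> 0 < r < e ->
  p z = (c * r)^-1 * circle_integral z r.
Proof.
move=> ze rI; rewrite (circle_integralE ze rI) mulKf// mulf_neq0//.
  by rewrite gt_eqF// pmulrn_rgt0// pi_gt0.
by case/andP: rI => /gt_eqF ->.
Qed.

(** Now the centre moves and the radius is fixed, so [e^(-i t)] is not cancelled: the integrand is
    the real part of [e^(-i t) (p - i q)], bounded by [M + M]. *)
Lemma is_derive_circle_integral_re z r : box z0 e z -> `|r| < e ->
  is_derive z.1 1 (fun s => circle_integral (s, z.2) r)
   (\int[mu]_(t in `[0, c])
      (p (circ z r t) * cos t - q (circ z r t) * sin t)).
Proof.
move=> [z1 z2] re.
have ball x : `|x - z.1| < e - `|z.1 - z0.1| -> box z0 e (x, z.2).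
  by move=> xr; split => //=; have := ler_distD z.1 x z0.1; lra.
have -> : z = (z.1, z.2) by case: (z).
rewrite /circle_integral.
apply: (@is_derive_Rintegral _ c (fun x => integrand (x, z.2) r)
  (fun x t => p (circ (x, z.2) r t) * cos t - q (circ (x, z.2) r t) * sin t) _
  (e - `|z.1 - z0.1|) (M + M)).
- by rewrite subr_gt0.
- by move=> x /ball xe; exact: continuous_integrand.
- move=> x t /ball xe.
  have h1 := is_derive_add (is_derive_id x 1) (is_derive_cst (r * cos t) x 1).
  have h2 := is_derive_cst (z.2 + r * sin t) x 1.
  have zB := circ_box t xe re.
  have hu := @is_derive_re_curve (fun x => x + r * cos t)
    (fun=> z.2 + r * sin t) _ _ _ zB h1 h2.
  have hv := @is_derive_im_curve (fun x => x + r * cos t)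
    (fun=> z.2 + r * sin t) _ _ _ zB h1 h2.
  have h := is_derive_add (is_derive_mul hu (is_derive_cst (cos t) x 1))
    (is_derive_mul hv (is_derive_cst (sin t) x 1)).
  by apply: (is_derive_eq h); rewrite /cst /circ/=; ring.
- move=> x t /ball xe; have zB := circ_box t xe re.
  apply: le_trans (ler_normB _ _) _; rewrite !normrM lerD//.
    apply: le_trans _ (pM zB); rewrite ler_piMr//; exact: cos_max.
  apply: le_trans _ (qM zB); rewrite ler_piMr//; exact: sin_max.
Qed.

Lemma is_derive_circle_integral_im z r : box z0 e z -> `|r| < e ->
  is_derive z.2 1 (fun s => circle_integral (z.1, s) r)
   (\int[mu]_(t in `[0, c])
      (q (circ z r t) * cos t + p (circ z r t) * sin t)).
Proof.
move=> [z1 z2] re.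
have ball x : `|x - z.2| < e - `|z.2 - z0.2| -> box z0 e (z.1, x).
  by move=> xr; split => //=; have := ler_distD z.2 x z0.2; lra.
have -> : z = (z.1, z.2) by case: (z).
rewrite /circle_integral.
apply: (@is_derive_Rintegral _ c (fun x => integrand (z.1, x) r)
  (fun x t => q (circ (z.1, x) r t) * cos t + p (circ (z.1, x) r t) * sin t) _
  (e - `|z.2 - z0.2|) (M + M)).
- by rewrite subr_gt0.
- by move=> x /ball xe; exact: continuous_integrand.
- move=> x t /ball xe.
  have h1 := is_derive_cst (z.1 + r * cos t) x 1.
  have h2 := is_derive_add (is_derive_id x 1) (is_derive_cst (r * sin t) x 1).
  have zB := circ_box t xe re.
  have hu := @is_derive_re_curve (fun=> z.1 + r * cos t)
    (fun x => x + r * sin t) _ _ _ zB h1 h2.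
  have hv := @is_derive_im_curve (fun=> z.1 + r * cos t)
    (fun x => x + r * sin t) _ _ _ zB h1 h2.
  have h := is_derive_add (is_derive_mul hu (is_derive_cst (cos t) x 1))
    (is_derive_mul hv (is_derive_cst (sin t) x 1)).
  by apply: (is_derive_eq h); rewrite /cst /circ/=; ring.
- move=> x t /ball xe; have zB := circ_box t xe re.
  apply: le_trans (ler_normD _ _) _; rewrite !normrM lerD//.
    apply: le_trans _ (qM zB); rewrite ler_piMr//; exact: cos_max.
  apply: le_trans _ (pM zB); rewrite ler_piMr//; exact: sin_max.
Qed.

End CauchyRiemann.

(** [P] is an explicit circle integral. The formula for [p] is differentiated in the first variable,
    and the one for [- q], coming from the pair rotated by [- i], in the second; both give the same
    integral, so [u] is harmonic. *)
Lemma cauchy_riemann_second (R : realType) (D : set (R * R))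
    (u v p q : R * R -> R) (z : R * R) :
  open D -> D z -> cauchy_riemann D u v p q ->
  exists P, is_derive z.1 1 (fun s => p (s, z.2)) P /\
            is_derive z.2 1 (fun s => q (z.1, s)) (- P).
Proof.
move=> oD Dz uvD.
have [_ _ cp cq] := uvD.
have nD : nbhs z D by exact: open_nbhs_nbhs.
have /cvgrPdist_lt /(_ 1 ltr01) np := cp z Dz.
have /cvgrPdist_lt /(_ 1 ltr01) nq := cq z Dz.
have [d d0 dD] := (nbhs_box _ _).1 (filterI (filterI np nq) nD).
pose e := d / 2; have e0 : 0 < e by rewrite divr_gt0.
have eB w : box z (e + e) w -> [/\ `|p z - p w| < 1, `|q z - q w| < 1 & D w].
  by rewrite -splitr => /dD[[]].
(* On the box [p] and [q] differ by less than 1 from their values at [z], so one constant bounds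
   both. *)
pose M := `|p z| + `|q z| + 1.
have pM w : box z (e + e) w -> `|p w| <= M.
  move=> /eB[pw _ _]; rewrite /M -(subKr (p z) (p w)).
  by have := ler_normB (p z) (p z - p w); have := normr_ge0 (q z); lra.
have qM w : box z (e + e) w -> `|q w| <= M.
  move=> /eB[_ qw _]; rewrite /M -(subKr (q z) (q w)).
  by have := ler_normB (q z) (q z - q w); have := normr_ge0 (p z); lra.
have uvB : cauchy_riemann (box z (e + e)) u v p q.
  have [uD vD _ _] := uvD.
  by split=> w /eB[_ _ Dw]; [exact: uD|exact: vD|exact: cp|exact: cq].
have vuB := cauchy_riemann_rot uvB.
have nqM w : box z (e + e) w -> `|- q w| <= M by rewrite normrN; exact: qM.
pose r := e / 2; have rI : 0 < r < e by rewrite /r; apply/andP; split; lra.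
have re : `|r| < e by case/andP: rI => r0; rewrite gtr0_norm.
have ze : box z e z := box_center z e0.
have near1 : \forall s \near z.1, box z e (s, z.2).
  apply: (filterS _ (nbhsx_ballx z.1 _ e0)) => s; rewrite /ball/= distrC => sz.
  by split => //=; rewrite subrr normr0.
have near2 : \forall s \near z.2, box z e (z.1, s).
  apply: (filterS _ (nbhsx_ballx z.2 _ e0)) => s; rewrite /ball/= distrC => sz.
  by split => //=; rewrite subrr normr0.
exists ((pi *+ 2 * r)^-1 * \int[lebesgue_measure]_(t in `[0, pi *+ 2])
  (p (circ z r t) * cos t - q (circ z r t) * sin t)); split.
  have h := is_derive_mul (is_derive_cst (pi *+ 2 * r)^-1 z.1 1)
                          (is_derive_circle_integral_re uvB pM qM ze re).
  apply: is_derive_near; last by apply: (is_derive_eq h); rewrite /cst mul0r add0r.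
  by apply: filterS near1 => s se; rewrite (p_circle_integral uvB pM se rI).
(* For the rotated pair the roles of [p] and [q] are played by [- q] and [p], so the integrand
   [q cos + p sin] becomes [p cos - q sin]. *)
have h := is_derive_opp (is_derive_mul (is_derive_cst (pi *+ 2 * r)^-1 z.2 1)
                          (is_derive_circle_integral_im vuB nqM pM ze re)).
apply: is_derive_near; last first.
  by apply: (is_derive_eq h); rewrite /cst mul0r add0r; congr (- (_ * _));
     apply: eq_Rintegral => t _; rewrite mulNr.
by apply: filterS near2 => s se; rewrite -(p_circle_integral vuB nqM se rI) opprK.
Qed.

(** * Calculus of quaternion-valued functions *)

Section QuaternionDerivatives.
Context {R : realType}.
Local Notation H := (quat R).

Lemma is_deriveP {V W : normedModType R} (f : V -> W) x v df :
  is_derive x v f df <->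
  h^-1 *: (f (h *: v + x) - f x) @[h --> 0^'] --> df.
Proof.
split=> [[fxv <-]|fxv]; first exact: fxv.
by apply: DeriveDef; [apply: cvgP fxv|exact: cvg_lim].
Qed.

Lemma is_derive_clinear {V W U : normedModType R} (L : W -> U) (f : V -> W) x v df :
  linear L -> continuous L -> is_derive x v f df ->
  is_derive x v (L \o f) (L df).
Proof.
move=> lL cL /is_deriveP fdf; apply/is_deriveP.
have L0 : L 0 = 0.
  by apply: (addrI (L 0)); rewrite addr0 -{1}[L 0]scale1r -lL scale1r addr0.
have LB a b k : L (k *: (a - b)) = k *: (L a - L b).
  by rewrite -[k *: _]addr0 lL L0 addr0 addrC -scaleN1r lL scaleN1r addrC.
have -> : (fun h => h^-1 *: ((L \o f) (h *: v + x) - (L \o f) x)) =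
          L \o (fun h => h^-1 *: (f (h *: v + x) - f x)).
  by apply/funext => h /=; rewrite LB.
exact: (cvg_comp _ _ fdf (cL df)).
Qed.

(** Reduces quaternion-valued derivatives to real ones, to which the circle integrals and the mean
    value theorem apply. *)
Lemma is_derive_coord {V : normedModType R} (f : V -> H) x v df :
  is_derive x v f df <-> forall i, is_derive x v (fun y => f y 0 i) (df 0 i).
Proof.
have lq i : linear (fun y : H => y 0 i) by move=> a y w; rewrite !mxE.
have cq i : continuous (fun y : H => y 0 i) by exact: coord_continuous.
split=> [fdf i|hi]; first exact: (is_derive_clinear (lq i) (cq i) fdf).
have fd : derivable f x v.
  by apply/derivable_mxP => i j; rewrite (ord1 i); have [] := hi j.
apply: DeriveDef => //; apply/rowP => j.
have D1 := is_derive_clinear (lq j) (cq j) (derivableP fd).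
by have [_ <-] := D1; have [_ <-] := hi j.
Qed.

Lemma is_derive_quat {V : normedModType R} (f : V -> H) x v df :
  is_derive x v f df <->
  [/\ is_derive x v (@q0 R \o f) (q0 df), is_derive x v (@q1 R \o f) (q1 df),
      is_derive x v (@q2 R \o f) (q2 df) & is_derive x v (@q3 R \o f) (q3 df)].
Proof.
split=> [/is_derive_coord fdf|[h0 h1 h2 h3]]; first by split; exact: fdf.
apply/is_derive_coord => -[[|[|[|[|//]]]] i4].
- by rewrite (_ : Ordinal i4 = 0) //; apply: val_inj.
- by rewrite (_ : Ordinal i4 = 1) //; apply: val_inj.
- by rewrite (_ : Ordinal i4 = 2%:R) //; apply: val_inj.
- by rewrite (_ : Ordinal i4 = 3%:R) //; apply: val_inj.
Qed.

Implicit Types (f g : R -> H) (r : R -> R) (t : R).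

Lemma is_derive_qadd f g t df dg : is_derive t 1 f df -> is_derive t 1 g dg ->
  is_derive t 1 (fun s => f s + g s) (df + dg).
Proof. exact: is_deriveD. Qed.

Lemma is_derive_qmul f g t df dg : is_derive t 1 f df -> is_derive t 1 g dg ->
  is_derive t 1 (fun s => f s * g s) (df * g t + f t * dg).
Proof.
move=> /is_derive_quat[f0 f1 f2 f3] /is_derive_quat[g0 g1 g2 g3].
apply/is_derive_quat; split; rewrite /comp.
- under [X in is_derive _ _ X _]eq_fun do rewrite q0M.
  have h := is_derive_add (is_derive_add (is_derive_add (is_derive_mul f0 g0)
    (is_derive_opp (is_derive_mul f1 g1))) (is_derive_opp (is_derive_mul f2 g2)))
    (is_derive_opp (is_derive_mul f3 g3)).
  by apply: (is_derive_eq h); rewrite !quatE /=; ring.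
- under [X in is_derive _ _ X _]eq_fun do rewrite q1M.
  have h := is_derive_add (is_derive_add (is_derive_add (is_derive_mul f0 g1)
    (is_derive_mul f1 g0)) (is_derive_mul f2 g3))
    (is_derive_opp (is_derive_mul f3 g2)).
  by apply: (is_derive_eq h); rewrite !quatE /=; ring.
- under [X in is_derive _ _ X _]eq_fun do rewrite q2M.
  have h := is_derive_add (is_derive_add (is_derive_add (is_derive_mul f0 g2)
    (is_derive_opp (is_derive_mul f1 g3))) (is_derive_mul f2 g0))
    (is_derive_mul f3 g1).
  by apply: (is_derive_eq h); rewrite !quatE /=; ring.
- under [X in is_derive _ _ X _]eq_fun do rewrite q3M.
  have h := is_derive_add (is_derive_add (is_derive_add (is_derive_mul f0 g3)
    (is_derive_mul f1 g2)) (is_derive_opp (is_derive_mul f2 g1)))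
    (is_derive_mul f3 g0).
  by apply: (is_derive_eq h); rewrite !quatE /=; ring.
Qed.

Lemma is_derive_qscale r f t dr df : is_derive t 1 r dr -> is_derive t 1 f df ->
  is_derive t 1 (fun s => r s *: f s) (dr *: f t + r t *: df).
Proof.
move=> hr /is_derive_quat[f0 f1 f2 f3]; apply/is_derive_quat.
by split; rewrite /comp;
   [under [X in is_derive _ _ X _]eq_fun do rewrite q0Z
   |under [X in is_derive _ _ X _]eq_fun do rewrite q1Z
   |under [X in is_derive _ _ X _]eq_fun do rewrite q2Z
   |under [X in is_derive _ _ X _]eq_fun do rewrite q3Z];
   rewrite !qE; exact: is_derive_mul.
Qed.

Lemma is_derive_qcomp f r t df dr : is_derive (r t) 1 f df -> is_derive t 1 r dr ->
  is_derive t 1 (fun s => f (r s)) (dr *: df).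
Proof.
move=> /is_derive_quat[f0 f1 f2 f3] hr; apply/is_derive_quat.
by split; rewrite !qE mulrC; exact: (@is_derive1_comp _ (_ \o f) r).
Qed.

End QuaternionDerivatives.

(** * Lines and stem functions *)

Section Lines.
Context {R : realType}.

Lemma is_derive_partial1 {W : normedModType R} (g : R * R -> W) (z : R * R) (dg : W) :
  is_derive z (1, 0) g dg -> is_derive z.1 1 (fun s => g (s, z.2)) dg.
Proof.
move=> /is_deriveP gd; apply/is_deriveP; apply: cvg_trans gd.
apply: near_eq_cvg; near=> h.
have -> : h *: ((1, 0) : R * R) + z = (h *: 1 + z.1, z.2).
  by rewrite [LHS]surjective_pairing /= scaler0 add0r.
by case: (z).
Unshelve. all: by end_near. Qed.

Lemma is_derive_partial2 {W : normedModType R} (g : R * R -> W) (z : R * R) (dg : W) :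
  is_derive z (0, 1) g dg -> is_derive z.2 1 (fun s => g (z.1, s)) dg.
Proof.
move=> /is_deriveP gd; apply/is_deriveP; apply: cvg_trans gd.
apply: near_eq_cvg; near=> h.
have -> : h *: ((0, 1) : R * R) + z = (z.1, h *: 1 + z.2).
  by rewrite [LHS]surjective_pairing /= scaler0 add0r.
by case: (z).
Unshelve. all: by end_near. Qed.

Lemma line_cvg {V : normedModType R} (x v : V) :
  (fun t : R => t *: v + x) @ (0 : R) --> x.
Proof.
rewrite -[X in _ --> X]add0r -(scale0r v).
by apply: cvgD; [exact: scalel_continuous|exact: cvg_cst].
Qed.

Lemma derive_line {V W : normedModType R} (f : V -> W) x v (t : R) :
  'D_v f (t *: v + x) = 'D_1 (fun s : R => f (s *: v + x)) t.
Proof.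
rewrite /derive; congr (lim _).
rewrite (_ : (fun h => h^-1 *: (f (h *: v + (t *: v + x)) - _)) =
  (fun h => h^-1 *: (f ((h *: 1 + t) *: v + x) - f (t *: v + x))))//.
by apply/funext => h; rewrite [h *: 1]mulr1 scalerDl addrA.
Qed.

(** Computes iterated directional derivatives from a closed form on the line. The first derivative
    must be known near 0, not only at 0, since it is differentiated again. *)
Lemma derive2_line {V W : normedModType R} (f : V -> W) x v
    (g g' : R -> W) (g'' : W) :
  (\forall t \near (0 : R), f (t *: v + x) = g t) ->
  (\forall t \near (0 : R), is_derive (t : R) 1 g (g' t)) ->
  is_derive (0 : R) 1 g' g'' ->
  'D_v f x = g' 0 /\ 'D_v ('D_v f) x = g''.
Proof.
move=> fg gg' hg''.
(* Agreement of [f] and [g] near 0 is also agreement near every [t] close to 0, as needed to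
   differentiate at [t]. *)
have fg2 := nbhs_interior fg.
have Df : \forall t \near (0 : R), 'D_v f (t *: v + x) = g' t.
  near=> t; rewrite derive_line.
  have tfg : \near t, f (t *: v + x) = g t by near: t; exact: fg2.
  rewrite (near_eq_derive _ tfg).
  by have [] : is_derive t 1 g (g' t) by near: t.
have E y : y = (0 : R) *: v + y :> V by rewrite scale0r add0r.
split; first by rewrite [X in 'D_v f X]E (nbhs_singleton Df).
rewrite [X in 'D_v _ X]E derive_line (near_eq_derive _ Df).
by have [] := hg''.
Unshelve. all: by end_near. Qed.

End Lines.

(** * Harmonicity of the components of a holomorphic stem function *)

Section HolomorphicStems.
Context {R : realType}.
Local Notation H := (quat R).
Variables (D : set (R * R)) (F : R * R -> H * H).
Hypotheses (oD : open D) (hF : holomorphic_stem D F).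
Local Notation Fa := ('D_(1, 0) F).
Local Notation Fb := ('D_(0, 1) F).

Lemma holomorphic_stem_cr z : D z ->
  (Fb z).2 = (Fa z).1 /\ (Fb z).1 = - (Fa z).2.
Proof.
have [_ _ h0] := hF.
move=> /h0 /eqP; rewrite /dzbar scaler_eq0 invr_eq0 pnatr_eq0/= => /eqP E.
have /= E1 := congr1 fst E; have /= E2 := congr1 snd E.
split; first by apply/esym/eqP; rewrite -subr_eq0; apply/eqP.
by apply/eqP; rewrite -subr_eq0 opprK addrC; apply/eqP.
Qed.

Lemma is_derive_stem (L : H * H -> H) z : linear L -> continuous L -> D z ->
  is_derive z.1 1 (fun s => L (F (s, z.2))) (L (Fa z)) /\
  is_derive z.2 1 (fun s => L (F (z.1, s))) (L (Fb z)).
Proof.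
move=> lL cL Dz; have [_ /(_ _ Dz)[d1 d2 _ _] _] := hF.
have h1 := is_derive_clinear lL cL (derivableP d1).
have h2 := is_derive_clinear lL cL (derivableP d2).
by split; [exact: is_derive_partial1 h1|exact: is_derive_partial2 h2].
Qed.

Lemma linear_fst : linear (fst : H * H -> H). Proof. by []. Qed.
Lemma linear_snd : linear (snd : H * H -> H). Proof. by []. Qed.
Lemma continuous_fst : continuous (fst : H * H -> H).
Proof. by move=> z; exact: cvg_fst. Qed.
Lemma continuous_snd : continuous (snd : H * H -> H).
Proof. by move=> z; exact: cvg_snd. Qed.

Definition is_derive_stem1 z := @is_derive_stem fst z linear_fst continuous_fst.
Definition is_derive_stem2 z := @is_derive_stem snd z linear_snd continuous_snd.

Lemma stem_partials_continuous (L : H * H -> H) z : continuous L -> D z -> forall i,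
  {for z, continuous (fun w => L (Fa w) 0 i)} /\
  {for z, continuous (fun w => L (Fb w) 0 i)}.
Proof.
move=> cL Dz i; have [_ /(_ _ Dz)[_ _ c1 c2] _] := hF.
have cq : continuous (fun y : H => y 0 i) by exact: coord_continuous.
have cLi w : (fun w => L w 0 i) @ w --> L w 0 i.
  exact: (cvg_comp L (fun y : H => y 0 i) (cL w) (cq (L w))).
split; first exact: (cvg_comp Fa (fun w => L w 0 i) c1 (cLi _)).
exact: (cvg_comp Fb (fun w => L w 0 i) c2 (cLi _)).
Qed.

(** The central imaginary unit acts separately on each quaternion coordinate, so every coordinate is
    an ordinary Cauchy-Riemann pair. *)
Lemma stem_cauchy_riemann1 i : cauchy_riemann D
  (fun z => (F z).1 0 i) (fun z => (F z).2 0 i)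
  (fun z => (Fa z).1 0 i) (fun z => (Fb z).1 0 i).
Proof.
split=> z Dz.
- have [/is_derive_coord h1 /is_derive_coord h2] := is_derive_stem1 Dz.
  split; [exact: h1|exact: h2].
- have [/is_derive_coord h1 /is_derive_coord h2] := is_derive_stem2 Dz.
  have [E1 E2] := holomorphic_stem_cr Dz.
  split; first by rewrite E2 mxE opprK; exact: h1.
  by rewrite -E1; exact: h2.
- exact: (stem_partials_continuous continuous_fst Dz i).1.
- exact: (stem_partials_continuous continuous_fst Dz i).2.
Qed.

(** The coordinates of [- i (F1 + i F2)], whose real part is [F2]; the regularity theorem then
    applies to [F2] as well. *)
Lemma stem_cauchy_riemann2 i : cauchy_riemann D
  (fun z => (F z).2 0 i) (fun z => - (F z).1 0 i)
  (fun z => (Fa z).2 0 i) (fun z => (Fb z).2 0 i).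
Proof.
split=> z Dz.
- have [/is_derive_coord h1 /is_derive_coord h2] := is_derive_stem2 Dz.
  split; [exact: h1|exact: h2].
- have [/is_derive_coord h1 /is_derive_coord h2] := is_derive_stem1 Dz.
  have [E1 E2] := holomorphic_stem_cr Dz.
  split; first by rewrite E1; exact: is_derive_opp (h1 i).
  have -> : (Fa z).2 = - (Fb z).1 by rewrite E2 opprK.
  by rewrite mxE; exact: is_derive_opp (h2 i).
- exact: (stem_partials_continuous continuous_snd Dz i).1.
- exact: (stem_partials_continuous continuous_snd Dz i).2.
Qed.

Lemma stem_second z : D z -> exists S1 S2 : H,
  [/\ is_derive z.1 1 (fun s => (Fa (s, z.2)).1) S1,
      is_derive z.1 1 (fun s => (Fa (s, z.2)).2) S2,
      is_derive z.2 1 (fun s => (Fb (z.1, s)).1) (- S1) &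
      is_derive z.2 1 (fun s => (Fb (z.1, s)).2) (- S2)].
Proof.
move=> Dz.
(* The second derivatives exist coordinate by coordinate and are collected into row vectors. *)
have /choice[S1 h1] := fun i => cauchy_riemann_second oD Dz (stem_cauchy_riemann1 i).
have /choice[S2 h2] := fun i => cauchy_riemann_second oD Dz (stem_cauchy_riemann2 i).
exists (\row_i S1 i), (\row_i S2 i).
split; apply/is_derive_coord => i; rewrite !mxE.
- by have [] := h1 i.
- by have [] := h2 i.
- by have [] := h1 i.
- by have [] := h2 i.
Qed.

End HolomorphicStems.

(** * Second derivatives of slice functions *)

Section SliceDerivatives.
Context {R : realType}.
Local Notation H := (quat R).
Implicit Types (s t c : R) (x y e w : H) (D : set (R * R)).

Lemma q0_qIm x : q0 (qIm x) = 0.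
Proof. by rewrite /qIm /qi /qj /qk !quatE; ring. Qed.
Lemma q1_qIm x : q1 (qIm x) = q1 x.
Proof. by rewrite /qIm /qi /qj /qk !quatE; ring. Qed.
Lemma q2_qIm x : q2 (qIm x) = q2 x.
Proof. by rewrite /qIm /qi /qj /qk !quatE; ring. Qed.
Lemma q3_qIm x : q3 (qIm x) = q3 x.
Proof. by rewrite /qIm /qi /qj /qk !quatE; ring. Qed.
Definition qImE := (q0_qIm, q1_qIm, q2_qIm, q3_qIm).

(** The point of the closed upper half-plane at which [slice_fun] evaluates the stem function. *)
Definition slice_point x : R * R := (q0 x, qnorm (qIm x)).

Lemma qnorm_qIm_sqr x :
  qnorm (qIm x) ^+ 2 = q1 x ^+ 2 + q2 x ^+ 2 + q3 x ^+ 2.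
Proof. by rewrite qnorm_sqr !qImE expr0n add0r. Qed.

Lemma qnorm_ge0 x : 0 <= qnorm x. Proof. exact: sqrtr_ge0. Qed.

(** In a representation of [x] the second coordinate is determined up to sign, and the symmetry of
    [D] absorbs the sign. *)
Lemma Omega_slice_point D x : conj_invariant D -> Omega D x <-> D (slice_point x).
Proof.
move=> cD; split=> [[a [b [J [Dab /imunitP[J0 J1] ->]]]]|Dx].
  set y := _ + _.
  have y0 : q0 y = a by rewrite /y !quatE J0; ring.
  have yn : qnorm (qIm y) = `|b|.
    rewrite /qnorm -sqrtr_sqr; congr Num.sqrt; rewrite !qImE /y !quatE J0.
    by rewrite -[RHS]mulr1 -[X in _ = _ * X]J1; ring.
  rewrite /slice_point y0 yn; case: (ger0P b) => // b0; exact: cD Dab.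
have [n0|n0] := eqVneq (qIm x) 0.
  (* For real [x] the unit is multiplied by 0, so [qi] serves as an arbitrary choice. *)
  exists (q0 x), (qnorm (qIm x)), (qi R); split=> //.
    by apply/imunitP; rewrite /qi !qE; split=> //; ring.
  have -> : qnorm (qIm x) = 0 by apply/eqP; rewrite qnorm_eq0 n0.
  have := (congr1 (@q1 R) n0, congr1 (@q2 R) n0, congr1 (@q3 R) n0).
  rewrite !qImE !qE => -[[x1 x2] x3].
  by apply: quatP; rewrite /qi !quatE ?x1 ?x2 ?x3; ring.
have nn : qnorm (qIm x) != 0 by rewrite qnorm_eq0.
exists (q0 x), (qnorm (qIm x)), ((qnorm (qIm x))^-1 *: qIm x); split=> //.
  apply/imunitP; rewrite q0Z q1Z q2Z q3Z !qImE mulr0; split=> //.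
  by rewrite !exprMn -!mulrDr -qnorm_qIm_sqr -exprMn mulVf// expr1n.
by apply: quatP; rewrite !quatE; field.
Qed.

(* The left-hand side is what the product rule gives for the second derivative of
   F1 + (rho^-1 *: Im) * F2 along x + t e, where rho = |Im|, N = rho^-1 and
   c = <Im x, e>. On the right the direction enters only through c ^ 2 and
   c *: e, which are easily summed over e = i, j, k. *)
Lemma second_derivative_regroup (N c : R) (w e A1 B0 B1 S1 S2 : H) :
  let m := c * N in let k := c * N ^+ 3 in
  let m' := N - c ^+ 2 * N ^+ 3 in let k' := N ^+ 3 - 3 * (c ^+ 2 * N ^+ 5) in
  (m' *: A1 - m *: (m *: S1))
     + ((- k *: e - (k' *: w + k *: e)) * B0 + (N *: e - k *: w) * (m *: B1))
     + ((- k *: w + N *: e) * (m *: B1) + (N *: w) * (m' *: B1 - m *: (m *: S2)))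
  = m' *: (A1 + (N *: w) * B1) - (m ^+ 2) *: (S1 + (N *: w) * S2)
    - (2 * N ^+ 3) *: (c *: e * B0) - k' *: (w * B0)
    + (2 * N ^+ 2) *: (c *: e * B1) - (2 * N ^+ 2 * m ^+ 2) *: (w * B1).
Proof.
by move=> m k m' k'; apply: quatP; rewrite /m /k /m' /k' !quatE; ring.
Qed.

Section Axis.
Variables (D : set (R * R)) (F : R * R -> H * H).
Hypothesis hF : holomorphic_stem D F.
Local Notation Fa := ('D_(1, 0) F).
Local Notation Fb := ('D_(0, 1) F).
Variables (W : set H) (f : H -> H).
Hypotheses (oW : open W) (WD : forall x, W x -> D (slice_point x)).
Hypothesis fF : induced_on W F f.
Variable x : H.
Hypotheses (Wx : W x) (x_neq0 : qIm x != 0).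
Local Notation a := (q0 x).
Local Notation w := (qIm x).
Local Notation n := (qnorm w).

Let n_gt0 : 0 < n.
Proof. by rewrite lt_def qnorm_ge0 qnorm_eq0 x_neq0. Qed.

Lemma near_line v : \forall t \near (0 : R), W (t *: v + x).
Proof. by apply: line_cvg; exact: open_nbhs_nbhs. Qed.

(** Along a real line [Im x] is fixed, so the left factor [n^-1 *: w] is constant and only the stem
    function is differentiated. *)
Lemma derive_slice_real (S1 S2 : H) :
  is_derive a 1 (fun s => (Fa (s, n)).1) S1 ->
  is_derive a 1 (fun s => (Fa (s, n)).2) S2 ->
  'D_1 f x = (Fa (a, n)).1 + (n^-1 *: w) * (Fa (a, n)).2 /\
  'D_1 ('D_1 f) x = S1 + (n^-1 *: w) * S2.
Proof.
move=> hS1 hS2.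
have lq0 t : q0 (t *: 1 + x) = t + a by rewrite !quatE mulr1.
have lIm t : qIm (t *: 1 + x) = w.
  by apply: quatP; rewrite !quatE; ring.
have sh t : is_derive t 1 (fun s : R => s + a) 1.
  have h := is_derive_add (is_derive_id t 1) (is_derive_cst a t 1).
  by apply: (is_derive_eq h); rewrite addr0.
have shift (g : R -> H) t dg : is_derive (t + a) 1 g dg ->
    is_derive t 1 (fun s => g (s + a)) dg.
  move=> hg; have h := @is_derive_qcomp _ g (fun s => s + a) t _ _ hg (sh t).
  by apply: (is_derive_eq h); rewrite scale1r.
have mulc (g : R -> H) t dg : is_derive t 1 g dg ->
    is_derive t 1 (fun s => (n^-1 *: w) * g s) ((n^-1 *: w) * dg).
  move=> hg; have h := is_derive_qmul (is_derive_cst (n^-1 *: w) t 1) hg.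
  by apply: (is_derive_eq h); rewrite mul0r add0r.
pose g t := (F (t + a, n)).1 + (n^-1 *: w) * (F (t + a, n)).2.
pose g' t := (Fa (t + a, n)).1 + (n^-1 *: w) * (Fa (t + a, n)).2.
have fg : \forall t \near (0 : R), f (t *: 1 + x) = g t.
  apply: filterS (near_line 1) => t Wt.
  by rewrite (fF Wt) /slice_fun lq0 lIm.
have gg' : \forall t \near (0 : R), is_derive (t : R) 1 g (g' t).
  apply: filterS (near_line 1) => t Wt.
  have Dt : D (t + a, n) by have := WD Wt; rewrite /slice_point lq0 lIm.
  have [h1 _] := is_derive_stem1 hF Dt; have [h2 _] := is_derive_stem2 hF Dt.
  exact: is_derive_qadd (shift _ _ _ h1) (mulc _ _ _ (shift _ _ _ h2)).
have hg' : is_derive (0 : R) 1 g' (S1 + (n^-1 *: w) * S2).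
  have hS1' : is_derive (0 + a) 1 (fun s => (Fa (s, n)).1) S1 by rewrite add0r.
  have hS2' : is_derive (0 + a) 1 (fun s => (Fa (s, n)).2) S2 by rewrite add0r.
  exact: is_derive_qadd (shift _ _ _ hS1') (mulc _ _ _ (shift _ _ _ hS2')).
have [-> ->] := derive2_line fg gg' hg'.
by rewrite /g' add0r.
Qed.

(** Along a unit imaginary direction [q0] is fixed and [c] is the scalar product of [Im x] with [e].
    At [t = 0], [m] is the derivative of the norm and [- k] that of its inverse; [m'] and [k'] are
    the derivatives of [m] and [k]. *)
Lemma derive_slice_imaginary (e S1 S2 A1 B1 : H) (c : R) :
  q0 e = 0 -> qnorm e = 1 ->
  q1 x * q1 e + q2 x * q2 e + q3 x * q3 e = c ->
  is_derive n 1 (fun s => (Fb (a, s)).1) (- S1) ->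
  is_derive n 1 (fun s => (Fb (a, s)).2) (- S2) ->
  (Fb (a, n)).1 = A1 -> (Fb (a, n)).2 = B1 ->
  let N := n^-1 in let m := c * N in let k := c * N ^+ 3 in
  let m' := N - c ^+ 2 * N ^+ 3 in let k' := N ^+ 3 - 3 * (c ^+ 2 * N ^+ 5) in
  let B0 := (F (a, n)).2 in
  'D_e f x = m *: A1 + (N *: e - k *: w) * B0 + (N *: w) * (m *: B1) /\
  'D_e ('D_e f) x = m' *: (A1 + (N *: w) * B1) - (m ^+ 2) *: (S1 + (N *: w) * S2)
    - (2 * N ^+ 3) *: (c *: e * B0) - k' *: (w * B0)
    + (2 * N ^+ 2) *: (c *: e * B1) - (2 * N ^+ 2 * m ^+ 2) *: (w * B1).
Proof.
move=> e0 e1 ec hS1 hS2 <- <- /=.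
(* [P t] is the squared norm of [w + t *: e], expanded with [e] of norm 1. It is positive near 0,
   where its square root is therefore differentiable. *)
pose P t := n ^+ 2 + t * (2 * c) + t * t.
pose rho t := Num.sqrt (P t).
pose N t := (rho t)^-1.
have P0 : P 0 = n ^+ 2 by rewrite /P !mul0r !addr0.
have rho0 : rho 0 = n by rewrite /rho P0 sqrtr_sqr ger0_norm// ltW.
have N0 : N 0 = n^-1 by rewrite /N rho0.
have e2 : q1 e ^+ 2 + q2 e ^+ 2 + q3 e ^+ 2 = 1.
  by have := qnorm_sqr e; rewrite e0 e1 expr0n add0r expr1n => <-.
have lq0 t : q0 (t *: e + x) = a by rewrite !quatE e0; ring.
have lIm t : qIm (t *: e + x) = w + t *: e.
  by apply: quatP; rewrite !quatE ?e0; ring.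
have lP t : qnorm (w + t *: e) = rho t.
  rewrite /qnorm /rho /P; congr Num.sqrt.
  rewrite q0D q1D q2D q3D q0Z q1Z q2Z q3Z !qImE e0 qnorm_qIm_sqr -ec.
  by rewrite -[t * t]mulr1 -[X in _ = _ + _ * X]e2; ring.
have hP t : is_derive t 1 P (2 * (c + t)).
  have h := is_derive_add (is_derive_affine (n ^+ 2) (2 * c) t)
    (is_derive_mul (is_derive_id t 1) (is_derive_id t 1)).
  by apply: (is_derive_eq h); ring.
have Pgt0 : \forall t \near (0 : R), 0 < P t.
  have cP : P t @[t --> (0 : R)] --> P 0 := is_derive_continuous (hP 0).
  by apply: (cvgr_gt _ cP); rewrite P0 exprn_gt0.
have rho_gt0 t : 0 < P t -> 0 < rho t by move=> Pt; rewrite sqrtr_gt0.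
have hrho t : 0 < P t -> is_derive t 1 rho ((c + t) * N t).
  move=> Pt; have h := is_derive1_comp (is_derive1_sqrt Pt) (hP t).
  have rt : rho t != 0 by rewrite gt_eqF ?rho_gt0.
  apply: (is_derive_eq h); rewrite /N -/(rho t); field.
  exact: rt.
have hN t : 0 < P t -> is_derive t 1 N (- ((c + t) * N t ^+ 3)).
  move=> Pt; have rt : rho t != 0 by rewrite gt_eqF ?rho_gt0.
  have h := is_deriveV rt (hrho t Pt).
  apply: (is_derive_eq h); rewrite /N /GRing.scale/=; field.
  exact: rt.
have hct t : is_derive t 1 (fun s : R => c + s) 1.
  have h := is_derive_add (is_derive_cst c t 1) (is_derive_id t 1).
  by apply: (is_derive_eq h); rewrite add0r.
have hy t : is_derive t 1 (fun s => w + s *: e) e.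
  have h := is_derive_qadd (is_derive_cst w t 1)
    (is_derive_qscale (is_derive_id t 1) (is_derive_cst e t 1)).
  by apply: (is_derive_eq h); rewrite scaler0 addr0 add0r scale1r.
pose m t := (c + t) * N t.
pose k t := (c + t) * N t ^+ 3.
have hm : is_derive (0 : R) 1 m (n^-1 - c ^+ 2 * n^-1 ^+ 3).
  have P0' : 0 < P 0 by rewrite P0 exprn_gt0.
  have h := is_derive_mul (hct 0) (hN 0 P0').
  by apply: (is_derive_eq h); rewrite N0 addr0; ring.
have hk : is_derive (0 : R) 1 k (n^-1 ^+ 3 - 3 * (c ^+ 2 * n^-1 ^+ 5)).
  have P0' : 0 < P 0 by rewrite P0 exprn_gt0.
  have h := is_derive_mul (hct 0)
    (is_derive_mul (hN 0 P0') (is_derive_mul (hN 0 P0') (hN 0 P0'))).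
  have E : (fun s => (c + s) * (N s * (N s * N s))) = k.
    by apply/funext => s; rewrite /k !exprS expr0 mulr1.
  by rewrite E in h; apply: (is_derive_eq h); rewrite N0 addr0; ring.
have hcomp (g : R -> H) t dg : 0 < P t -> is_derive (rho t) 1 g dg ->
    is_derive t 1 (fun s => g (rho s)) (m t *: dg).
  by move=> Pt hg; exact: is_derive_qcomp hg (hrho t Pt).
(* The three arguments are the restriction to the line, its derivative for [t] near 0, and the
   derivative of the latter at 0 in the shape the product rule produces. *)
have [] := @derive2_line _ _ _ f x e
  (fun t => (F (a, rho t)).1 + (N t *: (w + t *: e)) * (F (a, rho t)).2)
  (fun t => m t *: (Fb (a, rho t)).1
     + (N t *: e - k t *: (w + t *: e)) * (F (a, rho t)).2
     + (N t *: (w + t *: e)) * (m t *: (Fb (a, rho t)).2))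
  ((((n^-1 - c ^+ 2 * n^-1 ^+ 3) *: (Fb (a, n)).1
         - (c * n^-1) *: ((c * n^-1) *: S1))
     + ((- (c * n^-1 ^+ 3) *: e - ((n^-1 ^+ 3 - 3 * (c ^+ 2 * n^-1 ^+ 5)) *: w
            + (c * n^-1 ^+ 3) *: e)) * (F (a, n)).2
       + (n^-1 *: e - (c * n^-1 ^+ 3) *: w) * ((c * n^-1) *: (Fb (a, n)).2))
     + ((- (c * n^-1 ^+ 3) *: w + n^-1 *: e) * ((c * n^-1) *: (Fb (a, n)).2)
       + (n^-1 *: w) * ((n^-1 - c ^+ 2 * n^-1 ^+ 3) *: (Fb (a, n)).2
         - (c * n^-1) *: ((c * n^-1) *: S2))))).
- apply: filterS (near_line e) => t Wt.
  by rewrite (fF Wt) /slice_fun lq0 lIm lP.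
- apply: (filterS _ (filterI (near_line e) Pgt0)) => t [Wt Pt].
  have Dt : D (a, rho t) by have := WD Wt; rewrite /slice_point lq0 lIm lP.
  have [_ h1] := is_derive_stem1 hF Dt; have [_ h2] := is_derive_stem2 hF Dt.
  have k1 := hcomp _ _ _ Pt h1; have k2 := hcomp _ _ _ Pt h2.
  have h := is_derive_qadd k1 (is_derive_qmul (is_derive_qscale (hN t Pt) (hy t)) k2).
  by apply: (is_derive_eq h); rewrite addrA scaleNr [- _ + _]addrC.
- have P0' : 0 < P 0 by rewrite P0 exprn_gt0.
  have Dx : D (a, rho 0) by rewrite rho0; exact: WD Wx.
  have [_ h1] := is_derive_stem1 hF Dx; have [_ h2] := is_derive_stem2 hF Dx.
  rewrite -{1}rho0 in hS1; rewrite -{1}rho0 in hS2.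
  have kA1 := is_derive_qscale hm (hcomp _ _ _ P0' hS1).
  have kB := hcomp _ _ _ P0' h2.
  have kB1 := is_derive_qscale hm (hcomp _ _ _ P0' hS2).
  have kN := hN 0 P0'.
  have kc : is_derive (0 : R) 1 (fun t => N t *: e - k t *: (w + t *: e))
      (- (c * n^-1 ^+ 3) *: e - ((n^-1 ^+ 3 - 3 * (c ^+ 2 * n^-1 ^+ 5)) *: w
            + (c * n^-1 ^+ 3) *: e)).
    have h := is_deriveB (is_derive_qscale kN (is_derive_cst e (0 : R) 1))
                         (is_derive_qscale hk (hy 0)).
    apply: (is_derive_eq h).
    by rewrite /k N0 addr0 scaler0 addr0 scale0r addr0.
  have h := is_derive_qadd (is_derive_qadd kA1 (is_derive_qmul kc kB))
    (is_derive_qmul (is_derive_qscale kN (hy 0)) kB1).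
  apply: (is_derive_eq h).
  by rewrite /k /m N0 rho0 addr0 scale0r addr0 !scalerN.
- rewrite /m /k N0 rho0 addr0 scale0r addr0 => -> ->; split=> //.
  exact: second_derivative_regroup.
Qed.

End Axis.

End SliceDerivatives.

(** * Summation over the directions i, j, k *)

Section Algebra.
Context {R : realType}.
Local Notation H := (quat R).

(** The term [e * (e * B0)] gives [- B0]; in all others the direction enters only through [c *: e],
    and these add up to [Im x]. *)
Lemma crf_term (N c : R) (e w P Q B0 : H) : e * e = -1 ->
  e * ((c * N) *: (- Q) + (N *: e - (c * N ^+ 3) *: w) * B0
       + (N *: w) * ((c * N) *: P)) =
  - N *: B0 - N *: (c *: e * Q) - N ^+ 3 *: (c *: e * (w * B0))
  + N ^+ 2 *: (c *: e * (w * P)).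
Proof.
move=> ee; rewrite !mulrDr mulrBl mulrBr -!(@scalerAl _ H, @scalerAr _ H).
rewrite [e * (e * B0)]mulrA ee mulN1r mulrN.
move: (e * (w * P)) (e * (w * B0)) (e * Q) => X Y Z.
by apply: quatP; rewrite !qE; ring.
Qed.

Lemma qIm_sqr (x : H) : qIm x * qIm x = - (qnorm (qIm x) ^+ 2)%:A.
Proof. by rewrite qnorm_qIm_sqr; apply: quatP; rewrite !quatE; ring. Qed.

Lemma qIm_mul2 (x y : H) : qIm x * (qIm x * y) = - (qnorm (qIm x) ^+ 2) *: y.
Proof. by rewrite mulrA qIm_sqr mulNr -(@scalerAl _ H) mul1r scaleNr. Qed.

Lemma qi_sqr : qi R * qi R = -1.
Proof. by apply: quatP; rewrite /qi !quatE; ring. Qed.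
Lemma qj_sqr : qj R * qj R = -1.
Proof. by apply: quatP; rewrite /qj !quatE; ring. Qed.
Lemma qk_sqr : qk R * qk R = -1.
Proof. by apply: quatP; rewrite /qk !quatE; ring. Qed.

(** As the square of [w] is [- n ^ 2], with [n] the norm of [w], the terms in [P] and in [Q] cancel.
    Each direction contributes [- N *: B0], and the product [w * (w * B0)] returns one [N *: B0]. *)
Lemma crf_sum (x P Q B0 : H) : qIm x != 0 ->
  let w := qIm x in let N := (qnorm w)^-1 in
  let d e c := (c * N) *: (- Q) + (N *: e - (c * N ^+ 3) *: w) * B0
               + (N *: w) * ((c * N) *: P) in
  P + (N *: w) * Q + qi R * d (qi R) (q1 x) + qj R * d (qj R) (q2 x)
  + qk R * d (qk R) (q3 x) = - 2 *: (N *: B0).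
Proof.
move=> x0 w N d; rewrite /d !crf_term ?qi_sqr ?qj_sqr ?qk_sqr//.
have Nn : N * qnorm w = 1 by rewrite mulVf// qnorm_eq0.
(* Eliminating the [qi] term in favour of [w] makes the sum over the three directions collapse. *)
have wE (y : H) : q1 x *: qi R * y = w * y - q2 x *: qj R * y - q3 x *: qk R * y.
  by rewrite /w /qIm !mulrDl [RHS]addrAC !addrK.
rewrite !wE !qIm_mul2 -scalerAl.
have -> : N ^+ 3 *: (- qnorm w ^+ 2 *: B0 - q2 x *: qj R * (w * B0)
    - q3 x *: qk R * (w * B0)) = - N *: B0 - N ^+ 3 *: (q2 x *: qj R * (w * B0))
    - N ^+ 3 *: (q3 x *: qk R * (w * B0)).
  rewrite !scalerBr scalerA; congr (_ *: _ - _ - _).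
  by rewrite -[RHS]mulr1 -(expr1n R 2) -Nn; ring.
have -> : N ^+ 2 *: (- qnorm w ^+ 2 *: P - q2 x *: qj R * (w * P)
    - q3 x *: qk R * (w * P)) = - P - N ^+ 2 *: (q2 x *: qj R * (w * P))
    - N ^+ 2 *: (q3 x *: qk R * (w * P)).
  rewrite !scalerBr scalerA; congr (_ - _ - _).
  by rewrite mulrN -exprMn Nn expr1n scaleN1r.
move: (w * Q) (q2 x *: qj R * Q) (q3 x *: qk R * Q) => Q1 Q2 Q3.
move: (q2 x *: qj R * (w * B0)) (q3 x *: qk R * (w * B0)) => Y2 Y3.
move: (q2 x *: qj R * (w * P)) (q3 x *: qk R * (w * P)) => X2 X3.
by apply: quatP; rewrite !qE; ring.
Qed.

(** The sum of the squares of [x1], [x2], [x3] times [N ^ 2] is 1, so the coefficients of [V] sum to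
    0. The hypothesis is solved for a monomial, as [ring: hN] requires. *)
Lemma laplacian_linear_sum (N x1 x2 x3 : R) (X Y U1 U2 U3 V T1 T2 T3 Z : H) :
  let d c U T := (N - c ^+ 2 * N ^+ 3) *: X - ((c * N) ^+ 2) *: Y
    - (2 * N ^+ 3) *: U - (N ^+ 3 - 3 * (c ^+ 2 * N ^+ 5)) *: V
    + (2 * N ^+ 2) *: T - (2 * N ^+ 2 * (c * N) ^+ 2) *: Z in
  N ^+ 2 * x1 ^+ 2 = 1 - N ^+ 2 * x2 ^+ 2 - N ^+ 2 * x3 ^+ 2 ->
  d x1 U1 T1 + d x2 U2 T2 + d x3 U3 T3 =
  (2 * N) *: X - Y - (2 * N ^+ 3) *: (U1 + U2 + U3)
    + (2 * N ^+ 2) *: (T1 + T2 + T3) - (2 * N ^+ 2) *: Z.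
Proof.
move=> d hN; apply: quatP; rewrite /d !qE.
- ring: hN.
- ring: hN.
- ring: hN.
- ring: hN.
Qed.

End Algebra.

(** * Closed formulas off the real axis *)

Section Formulas.
Context {R : realType}.
Local Notation H := (quat R).

Lemma qnorm_qi : qnorm (qi R) = 1.
Proof. by rewrite /qnorm /qi !qE !expr0n expr1n add0r !addr0 sqrtr1. Qed.
Lemma qnorm_qj : qnorm (qj R) = 1.
Proof. by rewrite /qnorm /qj !qE !expr0n expr1n !add0r !addr0 sqrtr1. Qed.
Lemma qnorm_qk : qnorm (qk R) = 1.
Proof. by rewrite /qnorm /qk !qE !expr0n expr1n !add0r sqrtr1. Qed.

Variables (D : set (R * R)) (F : R * R -> H * H).
Hypotheses (oD : open D) (cD : conj_invariant D) (oW : open (Omega D)).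
Hypothesis hF : holomorphic_stem D F.

(** By the Cauchy-Riemann equations the two terms of [dz] coincide, and their half-sum is the
    derivative in the first variable. *)
Lemma slice_derivativeE x : Omega D x ->
  slice_derivative F x = ('D_(1, 0) F (slice_point x)).1
    + ((qnorm (qIm x))^-1 *: qIm x) * ('D_(1, 0) F (slice_point x)).2.
Proof.
move=> /(Omega_slice_point x cD) Dx; have [E1 E2] := holomorphic_stem_cr hF Dx.
have half (y : H) : 2^-1 *: (y + y) = y.
  by rewrite -mulr2n -[y *+ 2]scaler_nat scalerA mulVf ?scale1r// pnatr_eq0.
set z := slice_point x in Dx E1 E2 *.
have dz1 : (dz F z).1 = 2^-1 *: (('D_(1, 0) F z).1 - - ('D_(0, 1) F z).2) by [].
have dz2 : (dz F z).2 = 2^-1 *: (('D_(1, 0) F z).2 - ('D_(0, 1) F z).1) by [].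
have h1 : (dz F z).1 = ('D_(1, 0) F z).1.
  by apply: (etrans dz1); rewrite E1 opprK half.
have h2 : (dz F z).2 = ('D_(1, 0) F z).2.
  by apply: (etrans dz2); rewrite E2 opprK half.
by rewrite -h1 -h2.
Qed.

Variable f : H -> H.
Hypothesis fF : induced_on (Omega D) F f.
Variable x : H.
Hypotheses (Wx : Omega D x) (x0 : qIm x != 0).

Lemma qIm_conj : qIm (qconj x) = - qIm x.
Proof. by apply: quatP; rewrite !quatE; ring. Qed.

Lemma qnorm_opp (y : H) : qnorm (- y) = qnorm y.
Proof. by rewrite /qnorm !qE !sqrrN. Qed.

(** Passing to the conjugate changes the sign of [Im x] only: [F1] cancels and the [F2] term
    doubles. *)
Lemma spherical_derivativeE :
  spherical_derivative f x = (qnorm (qIm x))^-1 *: (F (slice_point x)).2.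
Proof.
have q0c : q0 (qconj x) = q0 x by rewrite !quatE; ring.
have pc : slice_point (qconj x) = slice_point x.
  by rewrite /slice_point q0c qIm_conj qnorm_opp.
have Wc : Omega D (qconj x).
  by apply/(Omega_slice_point _ cD); rewrite pc; apply/(Omega_slice_point _ cD).
rewrite /spherical_derivative (fF Wx) (fF Wc) /slice_fun -!/(slice_point _) pc.
rewrite qIm_conj qnorm_opp scalerN mulNr opprD opprK addrACA subrr add0r.
have double (y : H) : y + y = 2 *: y by rewrite scaler_nat mulr2n.
have iw : (qIm x)^-1 * qIm x = 1 by exact: mulVr.
move: (qIm x) (qIm x)^-1 iw => w i iw.
rewrite double -!(@scalerAl _ H, @scalerAr _ H) mulrA iw mul1r.
by rewrite !scalerA mulrA mulVf ?pnatr_eq0// mul1r.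
Qed.

(** The three members of (b) follow from these identities by linear algebra alone. *)
Lemma slice_derivatives_nonreal :
  [/\ 'D_1 f x = slice_derivative F x,
      CRF f x = - spherical_derivative f x &
      laplacian f x = - 2 *: (((qnorm (qIm x) ^+ 2)^-1 *: qIm x)
                   * (spherical_derivative f x - slice_derivative F x))].
Proof.
have WD y : Omega D y -> D (slice_point y) by move=> /(Omega_slice_point y cD).
have Dx := WD _ Wx.
have [S1 [S2 [hS1 hS2 hS3 hS4]]] := stem_second oD hF Dx.
have [CR2 CR1] := holomorphic_stem_cr hF Dx.
rewrite slice_derivativeE// spherical_derivativeE.
have [d0 d00] := derive_slice_real hF oW WD fF Wx hS1 hS2.
have ci : q1 x * q1 (qi R) + q2 x * q2 (qi R) + q3 x * q3 (qi R) = q1 x.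
  by rewrite /qi !qE; ring.
have cj : q1 x * q1 (qj R) + q2 x * q2 (qj R) + q3 x * q3 (qj R) = q2 x.
  by rewrite /qj !qE; ring.
have ck : q1 x * q1 (qk R) + q2 x * q2 (qk R) + q3 x * q3 (qk R) = q3 x.
  by rewrite /qk !qE; ring.
have DI (e : H) (c : R) e0 e1 ec := @derive_slice_imaginary _ D F hF
  (Omega D) f oW WD fF x Wx x0 e S1 S2 _ _ c e0 e1 ec hS3 hS4 CR1 CR2.
have [d1 d11] := DI _ _ (q0_mk _ _ _ _) qnorm_qi ci.
have [d2 d22] := DI _ _ (q0_mk _ _ _ _) qnorm_qj cj.
have [d3 d33] := DI _ _ (q0_mk _ _ _ _) qnorm_qk ck.
move: d0 d1 d2 d3 d00 d11 d22 d33; rewrite -/(slice_point x).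
move: ('D_(1, 0) F (slice_point x)).1 ('D_(1, 0) F (slice_point x)).2.
move: (F (slice_point x)).2 => B0 P Q d0 d1 d2 d3 d00 d11 d22 d33.
split; first exact: d0.
  rewrite /CRF d0 d1 d2 d3 (crf_sum P Q B0 x0).
  by rewrite scalerA mulrN mulVf ?pnatr_eq0// scaleN1r.
rewrite /laplacian d00 d11 d22 d33.
have n0 : qnorm (qIm x) != 0 by rewrite qnorm_eq0.
set w := qIm x; set N := (qnorm w)^-1.
have nN : N ^+ 2 * qnorm w ^+ 2 = 1 by rewrite -exprMn mulVf// expr1n.
have hN : N ^+ 2 * q1 x ^+ 2 = 1 - N ^+ 2 * q2 x ^+ 2 - N ^+ 2 * q3 x ^+ 2.
  by rewrite -nN qnorm_qIm_sqr; ring.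
(* With [J = N *: w], the fifth argument is [J (P + J Q)], and the sixth is the second derivative in
   the real direction, which cancels against its negative in the sum. *)
have L := @laplacian_linear_sum _ N (q1 x) (q2 x) (q3 x)
  (- Q + (N *: w) * P) (S1 + (N *: w) * S2)
  (q1 x *: qi R * B0) (q2 x *: qj R * B0) (q3 x *: qk R * B0) (w * B0)
  (q1 x *: qi R * P) (q2 x *: qj R * P) (q3 x *: qk R * P) (w * P) hN.
cbv zeta beta in L.
have assoc4 (p q r s : H) : p + q + r + s = p + (q + r + s) by rewrite !addrA.
rewrite [LHS]assoc4 [X in _ + X = _]L -!mulrDl -/(qIm x) -/w.
rewrite -!(@scalerAl _ H, @scalerAr _ H) mulrBr mulrDr -!(@scalerAl _ H, @scalerAr _ H).
rewrite qIm_mul2 -[(qnorm w ^+ 2)^-1]exprVn -/N.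
move: (w * S2) (w * P) (w * B0) => X Y Z.
apply: quatP; rewrite !qE.
- ring: nN.
- ring: nN.
- ring: nN.
- ring: nN.
Qed.

End Formulas.

(** * Harmonic slice-regular functions are affine *)

Section Affine.
Context {R : realType}.
Local Notation H := (quat R).
Implicit Types (s t : R) (x y a b : H).

Lemma is_derive0_eq (g : R -> H) (r s : R) :
  (forall t, (r <= t <= s) || (s <= t <= r) -> is_derive t 1 g 0) -> g r = g s.
Proof.
wlog rs : r s / r <= s => [W|] hg.
  have [/W->//|/ltW sr] := leP r s.
  by apply/esym/(W _ _ sr) => t; rewrite orbC; exact: hg.
apply/rowP => i.
have h t : t \in `[r, s] -> is_derive t 1 (fun t => g t 0 i) 0.
  rewrite in_itv/= => tI; have /hg/is_derive_coord /(_ i) : (r <= t <= s) || (s <= t <= r).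
    by rewrite tI.
  by rewrite mxE.
have h1 t : t \in `]r, s[ -> is_derive t 1 (fun t => g t 0 i) ((fun=> 0) t).
  by move=> /subset_itv_oo_cc/h.
have h2 : {within `[r, s], continuous (fun t => g t 0 i)}.
  by apply: derivable_within_continuous => t /h[].
have [c _ /eqP] := MVT_segment rs h1 h2.
by rewrite mul0r subr_eq0 => /eqP.
Qed.

(** Comparing the values at [x] and at [x] plus a small real number isolates [a]; the value at [x]
    then gives [b]. *)
Lemma affine_germ_inj x a b a' b' :
  (\forall y \near x, y * a + b = y * a' + b') -> a = a' /\ b = b'.
Proof.
move=> E; have /= E0 := nbhs_singleton E.
have /nbhs_ballP[d /= d0 dE] := line_cvg (1 : H) E.
have /dE /= : ball (0 : R) d (d / 2).
  by rewrite /ball/= sub0r normrN gtr0_norm ?divr_gt0// ltr_pdivrMr// mulr_natr mulr2n ltrDl.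
rewrite !mulrDl -!(@scalerAl _ H) !mul1r -!addrA E0 => /addIr aa.
have {aa} : a = a' by apply: scalerI aa; rewrite gt_eqF// divr_gt0.
by move=> aa; split => //; move: E0; rewrite aa => /addrI.
Qed.

(** The points with a given affine germ form an open set. By uniqueness of germs, its complement in
    [W] is covered by the analogous open sets for other coefficients, so it is also relatively
    closed. *)
Lemma connected_affine (W : set H) (f : H -> H) : connected W ->
  (forall x, W x -> exists a b, \forall y \near x, f y = y * a + b) ->
  exists a b, forall x, W x -> f x = x * a + b.
Proof.
move=> cW loc; have [[x0 Wx0]|W0] := pselect (W !=set0); last first.
  by exists 0, 0 => x Wx; exfalso; apply: W0; exists x.
have [a0 [b0 E0]] := loc x0 Wx0.
pose E a b : set H := [set x : H | \forall y \near x, f y = y * a + b].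
have oE a b : open (E a b) by rewrite openE => x; exact: nbhs_interior.
have EW : W `&` E a0 b0 = W.
  apply: cW; first by exists x0.
    by exists (E a0 b0).
  pose C := \bigcup_(ab in [set ab : H * H | ab != (a0, b0)]) E ab.1 ab.2.
  exists (~` C); first by apply: open_closedC; apply: bigcup_open => ab _; exact: oE.
  apply/seteqP; split=> x [Wx Ex]; split=> //.
    move=> [[a b] /= /eqP ab Eab]; apply: ab.
    have [] // := @affine_germ_inj x a b a0 b0; last by move=> -> ->.
    by apply: filterS (filterI Eab Ex) => y [<- <-].
  have [a [b Eab]] := loc x Wx.
  have [ab|ab] := eqVneq (a, b) (a0, b0); first by case: ab Eab => -> ->.
  by exfalso; apply: Ex; exists (a, b).
by exists a0, b0 => x Wx; move: (Wx); rewrite -{1}EW => -[_ /nbhs_singleton].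
Qed.

Lemma slice_point_continuous : continuous (@slice_point R).
Proof.
have cq i : continuous (fun y : H => y 0 i) by exact: coord_continuous.
have cs i : continuous (fun y : H => y 0 i ^+ 2).
  by move=> y; exact: (cvg_comp (fun y : H => y 0 i) (fun r => r ^+ 2) (cq i y)
    (@exprn_continuous R 2 (y 0 i))).
have -> : @slice_point R = (fun y => (y 0 0,
    Num.sqrt (y 0 1 ^+ 2 + y 0 2%:R ^+ 2 + y 0 3%:R ^+ 2))).
  apply/funext => y; congr pair; rewrite /qnorm; congr Num.sqrt.
  by rewrite !qImE expr0n add0r.
move=> y; have c0 := cq 0 y.
have c3 : {for y, continuous
    (fun y : H => y 0 1 ^+ 2 + y 0 2%:R ^+ 2 + y 0 3%:R ^+ 2)}.
  exact: (continuousD (continuousD (cs 1 y) (cs 2%:R y)) (cs 3%:R y)).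
have cn := cvg_comp _ (@Num.sqrt R) c3 (@sqrt_continuous R _).
exact: (cvg_pair c0 cn).
Qed.

Variables (D : set (R * R)) (F : R * R -> H * H) (f : H -> H).
Hypotheses (oD : open D) (cD : conj_invariant D) (oW : open (Omega D)).
Hypotheses (hF : holomorphic_stem D F) (fF : induced_on (Omega D) F f).
Hypothesis f0 : forall x, Omega D x -> laplacian f x = 0.
Local Notation Fa := ('D_(1, 0) F).
Local Notation Fb := ('D_(0, 1) F).

Lemma harmonic_slice_derivative x : Omega D x -> qIm x != 0 ->
  spherical_derivative f x = slice_derivative F x.
Proof.
move=> Wx x0; have [_ _] := slice_derivatives_nonreal oD cD oW hF fF Wx x0.
rewrite f0// => /esym/eqP; rewrite scaler_eq0 oppr_eq0 pnatr_eq0/= -(@scalerAl _ H).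
rewrite scaler_eq0 invr_eq0 sqrf_eq0 qnorm_eq0 (negbTE x0)/= => /eqP E.
apply/eqP; rewrite -subr_eq0; apply/eqP.
have iw : (qIm x)^-1 * qIm x = 1 by exact: mulVr.
by rewrite -[LHS]mul1r -iw -mulrA E mulr0.
Qed.

Lemma harmonic_stem_partials z : D z -> 0 < z.2 ->
  (Fa z).2 = 0 /\ (Fa z).1 = z.2^-1 *: (F z).2.
Proof.
case: z => r s /= Dz s0.
have key (J : H) : imunit J -> (Fa (r, s)).1 + J * (Fa (r, s)).2 = s^-1 *: (F (r, s)).2.
  move=> /imunitP[J0 J1]; pose x : H := r%:A + s *: J.
  have Imx : qIm x = s *: J.
    by apply: quatP; rewrite /x !quatE ?J0; ring.
  have nx : qnorm (qIm x) = s.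
    rewrite Imx -[RHS]gtr0_norm// -sqrtr_sqr /qnorm; congr Num.sqrt.
    rewrite q0Z q1Z q2Z q3Z J0 -[RHS]mulr1 -J1; ring.
  have px : slice_point x = (r, s).
    by rewrite /slice_point nx /x !quatE J0; congr pair; ring.
  have Wx : Omega D x by apply/(Omega_slice_point _ cD); rewrite px.
  have x0 : qIm x != 0 by rewrite -qnorm_eq0 nx gt_eqF.
  have := harmonic_slice_derivative Wx x0.
  rewrite (slice_derivativeE cD hF Wx) (spherical_derivativeE cD fF Wx x0) px nx Imx.
  by rewrite scalerA mulVf ?gt_eqF// scale1r => ->.
(* In [key] the right-hand side and the stem values do not depend on [J]; comparing [qi] with its
   opposite annihilates the [J] term. *)
have i1 : imunit (qi R) by exact: qi_sqr.
have i2 : imunit (- qi R) by rewrite /imunit /= mulrNN qi_sqr.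
have E1 := key _ i1; have E2 := key _ i2.
have Q0 : (Fa (r, s)).2 = 0.
  have E : qi R * (Fa (r, s)).2 = - (qi R * (Fa (r, s)).2).
    by apply: (addrI (Fa (r, s)).1); rewrite E1 -E2 mulNr.
  have : qi R * (Fa (r, s)).2 = 0.
    move/eqP: E; rewrite -subr_eq0 opprK -mulr2n -scaler_nat scaler_eq0 pnatr_eq0/=.
    by move/eqP.
  move/(congr1 (fun y => qi R * y)); rewrite mulr0 mulrA qi_sqr mulN1r => /eqP.
  by rewrite oppr_eq0 => /eqP.
by split=> //; rewrite -E1 Q0 mulr0 addr0.
Qed.

(** Restricting to nonnegative height covers real points too: there the division by the height is
    replaced by a limit from above. *)
Lemma harmonic_stem_affine z : D z -> 0 <= z.2 -> exists a b,
  \forall w \near z, 0 <= w.2 ->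
    (F w).1 = w.1 *: a + b /\ (F w).2 = w.2 *: a.
Proof.
move=> Dz z0.
have [d d0 dD] := (nbhs_box _ _).1 (open_nbhs_nbhs (conj oD Dz)).
(* A base point inside the box and strictly above the real axis, even when [z] is real. *)
pose p := (z.1, z.2 + d / 2).
have part w : box z d w -> 0 < w.2 ->
    [/\ (Fa w).1 = w.2^-1 *: (F w).2, (Fa w).2 = 0, (Fb w).1 = 0 &
        (Fb w).2 = w.2^-1 *: (F w).2].
  move=> /dD Dw w0; have [Q P] := harmonic_stem_partials Dw w0.
  have [E2 E1] := holomorphic_stem_cr hF Dw.
  split; [exact: P|exact: Q| |exact: (etrans E2 P)].
  by apply: (etrans E1); rewrite Q oppr0.
have boxd r s : box z d (r, s) = (`|r - z.1| < d /\ `|s - z.2| < d) by [].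
have between (r s t c : R) : `|r - c| < d -> `|s - c| < d ->
    (r <= t <= s) || (s <= t <= r) -> `|t - c| < d.
  rewrite !ltr_norml => /andP[? ?] /andP[? ?].
  by move=> /orP[] /andP[? ?]; apply/andP; split; lra.
have between0 (r s t : R) : 0 < r -> 0 < s ->
    (r <= t <= s) || (s <= t <= r) -> 0 < t.
  by move=> r0 s0 /orP[] /andP[h _]; exact: lt_le_trans h.
have cst (g : R * R -> H) :
    (forall w, box z d w -> 0 < w.2 ->
      is_derive w.1 1 (fun r => g (r, w.2)) 0 /\
      is_derive w.2 1 (fun s => g (w.1, s)) 0) ->
    forall w, box z d w -> 0 < w.2 -> g w = g p.
  move=> hg [r s] [/= r1 s1] s0.
  have p1 : `|p.1 - z.1| < d by rewrite subrr normr0.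
  have p2 : `|p.2 - z.2| < d.
    by rewrite /p/= addrAC subrr add0r gtr0_norm ?divr_gt0//; move: d0; lra.
  have p0 : 0 < p.2 by rewrite /p/=; move: d0 z0; lra.
  (* First a horizontal, then a vertical segment; both stay in the upper part of the box. *)
  transitivity (g (p.1, s)).
    apply: (@is_derive0_eq (fun r => g (r, s))) => t tI.
    have := hg (t, s); rewrite boxd => /(_ (conj (between _ _ _ _ r1 p1 tI) s1) s0).
    by case.
  rewrite [p in RHS]surjective_pairing.
  apply: (@is_derive0_eq (fun s => g (p.1, s))) => t tI.
  have := hg (p.1, t); rewrite boxd.
  by move=> /(_ (conj p1 (between _ _ _ _ s1 p2 tI)) (between0 _ _ _ s0 p0 tI))[].
pose G w := w.2^-1 *: (F w).2.
have GE := cst G.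
have {}GE w : box z d w -> 0 < w.2 -> G w = G p.
  apply: GE => {}w wB w0; have Dw := dD _ wB.
  have [P Q Pb Qb] := part w wB w0.
  have [h1 h2] := is_derive_stem2 hF Dw.
  have w0' : w.2 != 0 by rewrite gt_eqF.
  split.
    have h := is_derive_qscale (is_derive_cst w.2^-1 w.1 1) h1.
    by apply: (is_derive_eq h); rewrite Q scaler0 scale0r addr0.
  have h := is_derive_qscale (is_deriveV w0' (is_derive_id w.2 1)) h2.
  apply: (is_derive_eq h); rewrite Qb [X in _ + X = _]scalerA -surjective_pairing -scalerDl.
  rewrite [_ *: (1 : R)]mulr1 -[(w.2 ^+ 2)^-1]exprVn -expr2.
  by rewrite addNr scale0r.
pose a := G p.
pose K w := (F w).1 - w.1 *: a.
have KE w : box z d w -> 0 < w.2 -> K w = K p.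
  apply: cst => {}w wB w0; have Dw := dD _ wB.
  have [P Q Pb Qb] := part w wB w0.
  have [h1 h2] := is_derive_stem1 hF Dw.
  have Pa : (Fa w).1 = a by rewrite P -/(G w) GE.
  split.
    have h := is_deriveB h1 (is_derive_qscale (is_derive_id w.1 1) (is_derive_cst a w.1 1)).
    by apply: (is_derive_eq h); rewrite Pa scale1r scaler0 addr0 subrr.
  have h := is_deriveB h2 (is_derive_cst (w.1 *: a) w.2 1).
  by apply: (is_derive_eq h); rewrite Pb subr0.
pose b := K p.
exists a, b.
have pos w : box z d w -> 0 < w.2 ->
    (F w).1 = w.1 *: a + b /\ (F w).2 = w.2 *: a.
  move=> wB w0; split; first by rewrite /b -(KE w)// addrC subrK.
  by rewrite /a -(GE w)// scalerA mulfV ?gt_eqF// scale1r.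
(* At height 0, [F2] vanishes by the stem symmetry, and [F1] is the limit of its values from
   above. *)
apply/nbhs_box; exists d => // w wB; rewrite le_eqVlt => /predU1P[w0|]; last exact: pos.
have Dw := dD _ wB; have [sF _ _] := hF.
have wE : w = (w.1, 0) by rewrite [LHS]surjective_pairing -w0.
have F2 : (F w).2 = 0.
  have := sF w Dw; rewrite {1}wE /cconj/= oppr0 -wE.
  move=> /(congr1 snd)/= /eqP.
  by rewrite -subr_eq0 opprK -mulr2n -scaler_nat scaler_eq0 pnatr_eq0/= => /eqP.
split; last by rewrite F2 -w0 scale0r.
have [_ h] := is_derive_stem1 hF Dw.
have cF : (F (w.1, s)).1 @[s --> w.2] --> (F (w.1, w.2)).1.
  by have [/derivable1_diffP/differentiable_continuous dh _] := h; exact: dh.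
rewrite [w in LHS]surjective_pairing.
have cF' : (F (w.1, s)).1 @[s --> w.2^'+] --> (F (w.1, w.2)).1.
  exact: cvg_at_right_filter cF.
have cc : (F (w.1, s)).1 @[s --> w.2^'+] --> w.1 *: a + b.
  apply: cvg_near_cst.
  have [w1 w2] := wB.
  have : \forall s \near w.2, box z d (w.1, s).
    have : \forall s \near w.2, `|s - z.2| < d.
      have := (@box_nbhs _ _ _ _ wB); rewrite nbhs_box => -[e e0 eB].
      apply: (filterS _ (nbhsx_ballx w.2 _ e0)) => s; rewrite /ball/= distrC => sw.
      by have [] := eB (w.1, s); first by split; rewrite //= subrr normr0.
    by apply: filterS => s s2.
  move=> /cvg_within near_box; near=> s.
  have sB : box z d (w.1, s) by near: s; exact: near_box.
  have s0 : 0 < s by rewrite {1}w0; near: s; exact: nbhs_right_gt.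
  by have [] := pos _ sB s0.
exact: (cvg_unique _ cF' cc).
Unshelve. all: by end_near. Qed.

Lemma harmonic_slice_affine x : Omega D x ->
  exists a b, \forall y \near x, f y = y * a + b.
Proof.
move=> Wx.
have Dx : D (slice_point x) by exact/(Omega_slice_point _ cD).
have [a [b ab]] := harmonic_stem_affine Dx (qnorm_ge0 _).
exists a, b.
have Wn : nbhs x (Omega D) by exact: open_nbhs_nbhs.
apply: filterS (filterI Wn (slice_point_continuous ab)) => y [Wy].
move=> /(_ (qnorm_ge0 _))[F1 F2].
rewrite (fF Wy) /slice_fun -/(slice_point y) F1 F2 /=.
have yE : y = (q0 y)%:A + qIm y by apply: quatP; rewrite !quatE; ring.
(* The norm cancels its inverse off the real axis, and both sides are 0 on it. *)
have nE : ((qnorm (qIm y))^-1 *: qIm y) * (qnorm (qIm y) *: a) = qIm y * a.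
  have [->|n0] := eqVneq (qIm y) 0; first by rewrite scaler0 !mul0r.
  by rewrite -(@scalerAl _ H) -(@scalerAr _ H) scalerA mulVf ?qnorm_eq0// scale1r.
have -> : y * a = q0 y *: a + qIm y * a.
  by rewrite {1}yE; move: (qIm y) => q; rewrite mulrDl mulr_algl.
by rewrite nE addrAC.
Qed.

End Affine.

Theorem lemma23 (R : realType) (D : set (R * R)) (W : set (quat R))
    (hW : axially_symmetric_domain D W) :
  (forall f : quat R -> quat R,
     slice_regular D f ->
     (forall x, W x -> laplacian f x = 0) ->
     exists a b : quat R, forall x, W x -> f x = x * a + b)
  /\
  (forall (f : quat R -> quat R) (F : R * R -> quat R * quat R),
     holomorphic_stem D F -> induced_on W F f ->
     forall x, W x -> qIm x != 0 ->
     [/\ laplacian f x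
         = - 2 *: (((qnorm (qIm x) ^+ 2)^-1 *: qIm x)
                   * (spherical_derivative f x - slice_derivative F x)),
         - 2 *: (((qnorm (qIm x) ^+ 2)^-1 *: qIm x)
                 * (spherical_derivative f x - slice_derivative F x))
         = 2 *: (((qnorm (qIm x) ^+ 2)^-1 *: qIm x)
                 * (CRF f x + slice_derivative F x))
       & 2 *: (((qnorm (qIm x) ^+ 2)^-1 *: qIm x)
               * (CRF f x + slice_derivative F x))
         = ((qnorm (qIm x) ^+ 2)^-1 *: qIm x)
           * (3 *: 'D_1 f x + qi R * 'D_(qi R) f x + qj R * 'D_(qj R) f x
              + qk R * 'D_(qk R) f x)]).
Proof.
have [oD cD WE oW cW] := hW; subst W.
split=> [f [F hF fF] f0|f F hF fF x Wx x0].
  exact: connected_affine cW (harmonic_slice_affine oD cD oW hF fF f0).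
have [D1 C L] := slice_derivatives_nonreal oD cD oW hF fF Wx x0.
split=> //.
  rewrite C -opprB; set v := (_ *: qIm x).
  by rewrite -opprB opprK [- _ + _]addrC mulrBr mulrBr !scaleNr -scalerN opprB.
(* The slice derivative is the derivative in the real direction, so it adds [2 *: 'D_1 f x] to the
   ['D_1 f x] already contained in twice [CRF f x]. *)
rewrite -D1 /CRF (@scalerAr _ (quat R)); congr (_ * _).
rewrite scalerDr scalerA mulfV ?pnatr_eq0// scale1r.
move: ('D_1 f x) (qi R * _) (qj R * _) (qk R * _) => d di dj dk.
have -> : 3 *: d = d + 2 *: d.
  by rewrite -{2}[d]scale1r -scalerDl; congr (_ *: _); ring.
by rewrite -!addrA; congr (d + _); rewrite [RHS]addrC -!addrA.
Qed.
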